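(* Let $X \subset \mathbb{C}^p$ be an $s$-dimensional (analytic, not necessarily toric) variety with isolated singularity at the origin and admitting smooth normalization $f:\mathbb{C}^s \to X$. Then $p \geq 2s$.
   Context: ''Isolated singularity at the origin'' means that $0\in X$ is a singular point of $X$ and that $X$ is nonsingular at every other point of some neighbourhood of $0$. ''Admitting smooth normalization $f:\mathbb{C}^s\to X$'' means that the normalization of $X$ is (isomorphic to) $\mathbb{C}^s$, with normalization map $f$. *)

(* Defs.v *)
From HB Require Import structures.
From mathcomp Require Import all_boot all_order all_algebra.
From mathcomp Require Import all_classical all_reals all_analysis.
From mathcomp Require Export complex.

Set Implicit Arguments.
Unset Strict Implicit.
Unset Printing Implicit Defensive.

Import GRing.Theory Num.Theory numFieldNormedType.Exports.

Local Open Scope classical_set_scope.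
Local Open Scope ring_scope.

(* The topology and the norm of the numFieldType R[i]: the balls are those of the
   complex modulus. *)
HB.instance Definition _ (R : realType) := NormedModule.copy R[i] (R[i]^o).

(* C^n is 'rV[R[i]]_n. All derivatives are taken over the scalar field R[i], so
   that [differentiable] is complex (Frechet) differentiability. *)

Section AnalyticSets.
Variable R : realType.
Local Notation C := R[i].

(* Holomorphy on a subset A that need not be open: f is, locally on A, the
   restriction of a holomorphic function of the ambient space. When A is open
   this is complex differentiability at every point of A. *)
Definition holomorphic_on (n m : nat) (A : set 'rV[C]_n)
    (f : 'rV[C]_n -> 'rV[C]_m) : Prop :=
  forall x, A x -> exists (U : set 'rV[C]_n) (g : 'rV[C]_n -> 'rV[C]_m),
    [/\ open U, U x, forall z, U z -> differentiable g z
      & forall z, U z -> A z -> f z = g z].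

Definition biholomorphic_on (n m : nat) (A : set 'rV[C]_n) (B : set 'rV[C]_m)
    (f : 'rV[C]_n -> 'rV[C]_m) : Prop :=
  exists g : 'rV[C]_m -> 'rV[C]_n,
    [/\ holomorphic_on A f, holomorphic_on B g,
        forall x, A x -> B (f x) /\ g (f x) = x
      & forall y, B y -> A (g y) /\ f (g y) = y].

(* The condition is imposed at all points of C^n, not only at those of X; in
   particular X is closed. *)
Definition analytic_set (n : nat) (X : set 'rV[C]_n) : Prop :=
  forall x, exists (U : set 'rV[C]_n) (k : nat) (g : 'rV[C]_n -> 'rV[C]_k),
    [/\ open U, U x, holomorphic_on U g
      & forall z, U z -> (X z <-> g z = 0)].

(* C^d x {0} in C^n *)
Definition coord_subspace (n d : nat) : set 'rV[C]_n :=
  [set z | forall i : 'I_n, (d <= i)%N -> z 0 i = 0].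

Definition regular_point (n : nat) (X : set 'rV[C]_n) (d : nat)
    (x : 'rV[C]_n) : Prop :=
  [/\ X x, (d <= n)%N
    & exists (U V : set 'rV[C]_n) (phi : 'rV[C]_n -> 'rV[C]_n),
        [/\ open U, open V, U x, biholomorphic_on U V phi
          & forall z, U z -> (X z <-> coord_subspace d (phi z))]].

Definition nonsingular_point (n : nat) (X : set 'rV[C]_n) (x : 'rV[C]_n) :=
  exists d, regular_point X d x.

Definition singular_point (n : nat) (X : set 'rV[C]_n) (x : 'rV[C]_n) :=
  X x /\ ~ nonsingular_point X x.

Definition isolated_singularity (n : nat) (X : set 'rV[C]_n) (x : 'rV[C]_n) :=
  singular_point X x /\
  \forall y \near x, X y -> y <> x -> nonsingular_point X y.

(* dim X = s, the dimension of an analytic set being the supremum of the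
   dimensions of the complex manifold X_reg. *)
Definition has_dim (n : nat) (X : set 'rV[C]_n) (s : nat) : Prop :=
  (exists x, regular_point X s x) /\
  (forall d x, regular_point X d x -> (d <= s)%N).

Definition finite_map (m n : nat) (f : 'rV[C]_m -> 'rV[C]_n) : Prop :=
  (forall K : set 'rV[C]_n, compact K -> compact (f @^-1` K)) /\
  (forall y, finite_set (f @^-1` [set y])).

(* f : C^s -> X is the normalization of X. A normalization is a finite
   surjective holomorphic map from a normal space which is biholomorphic over
   the complement of a nowhere dense analytic subset N of X, with nowhere dense
   preimage; the source C^s is a manifold, hence normal. *)
Definition is_smooth_normalization (s n : nat) (X : set 'rV[C]_n)
    (f : 'rV[C]_s -> 'rV[C]_n) : Prop :=
  [/\ holomorphic_on setT f, range f = X, finite_map f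
    & exists N : set 'rV[C]_n,
        [/\ analytic_set N, N `<=` X, X `<=` closure (X `\` N),
            dense (~` (f @^-1` N))
          & biholomorphic_on (~` (f @^-1` N)) (X `\` N) f]].

End AnalyticSets.

(* Main.v *)
(* Suppose f a = f b = 0 with a <> b, or a = b and df(a) not injective.  Were p < 2 s, the map
   (x, w) |-> (f (x + w) - f x) / w_i from C^(2 s) to C^p would have too small a target:
   a function |z|^2 - K |H z|^2 + delta ln |w_i| with H : C^n -> C^m holomorphic and m < n has
   no local maximum, because along a complex line in the kernel of dH the averages of the last
   two terms over small circles do not decrease to second order.  But f is injective and
   immersive away from the fibre of 0, so for large K this function is very negative on the
   boundary of a small ball around (a, b - a) and near w_i = 0, while it is almost nonnegative
   at (a, b - a), resp. at (a, t v) with df(a) v = 0 and t small: a contradiction.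
   In the remaining case f is an injective immersion over a neighbourhood of 0, and the inverse
   function theorem makes 0 a nonsingular point.

   Injectivity and immersivity of f over a nonsingular point say that the inverse of f, which is
   bounded and holomorphic off a proper analytic subset of a coordinate slice, is Lipschitz.
   The complex analysis required (maximum principle, Cauchy estimates) is derived from mere
   complex differentiability by Goursat's bisection, applied to trapezoid sums over dyadic
   subdivisions instead of integrals. *)

From mathcomp Require Import all_boot all_order all_algebra.
From mathcomp Require Import all_classical all_reals all_analysis.
From mathcomp Require Import ring lra.
Require Import Defs.
Set Implicit Arguments.
Unset Strict Implicit.
Unset Printing Implicit Defensive.
Import Order.TTheory GRing.Theory Num.Theory numFieldNormedType.Exports.
Local Open Scope classical_set_scope.
Local Open Scope ring_scope.

(** * Real-valued norms and complex derivatives *)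

Section RealNorm.
Variable R : realType.
Local Notation C := R[i].

Lemma realcD (x y : R) : (x + y)%:C%C = x%:C%C + y%:C%C :> C.
Proof. exact: (rmorphD (real_complex R)). Qed.

Lemma realcM (x y : R) : (x * y)%:C%C = x%:C%C * y%:C%C :> C.
Proof. exact: (rmorphM (real_complex R)). Qed.

(** Norms over [R[i]] take values in [R[i]]. Their real part carries the same information and lives
    in the ordered field [R], where [ln], [expR] and linear arithmetic are available. *)
Definition rnorm (V : normedModType R[i]) (v : V) : R := complex.Re `|v|.

Lemma rnormE (V : normedModType C) (v : V) : `|v| = (rnorm v)%:C%C.
Proof. by rewrite /rnorm RRe_real ?normr_real. Qed.

Lemma rnorm_ge0 (V : normedModType C) (v : V) : 0 <= rnorm v.
Proof. by rewrite -ler0c -rnormE. Qed.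

Lemma rnorm0 (V : normedModType C) : rnorm (0 : V) = 0.
Proof. by rewrite /rnorm normr0. Qed.

Lemma rnorm_eq0 (V : normedModType C) (v : V) : (rnorm v == 0) = (v == 0).
Proof. by rewrite -[RHS]normr_eq0 rnormE -[RHS]/(_%:C%C == 0%:C%C) (inj_eq (@complexI _)). Qed.

Lemma rnorm_gt0 (V : normedModType C) (v : V) : (0 < rnorm v) = (v != 0).
Proof. by rewrite lt_def rnorm_ge0 andbT rnorm_eq0. Qed.

Lemma rnormN (V : normedModType C) (v : V) : rnorm (- v) = rnorm v.
Proof. by rewrite /rnorm normrN. Qed.

Lemma rnormD (V : normedModType C) (v w : V) : rnorm (v + w) <= rnorm v + rnorm w.
Proof. by rewrite -lecR realcD -!rnormE ler_normD. Qed.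

Lemma rdistC (V : normedModType C) (v w : V) : rnorm (v - w) = rnorm (w - v).
Proof. by rewrite -rnormN opprB. Qed.

Lemma rnormB (V : normedModType C) (v w : V) : rnorm (v - w) <= rnorm v + rnorm w.
Proof. by rewrite -(rnormN w) rnormD. Qed.

Lemma rdist_trans (V : normedModType C) (w u v : V) :
  rnorm (u - v) <= rnorm (u - w) + rnorm (w - v).
Proof. by rewrite (le_trans _ (rnormD _ _)) // addrA subrK. Qed.

Lemma rdist_ge (V : normedModType C) (v w : V) : rnorm v - rnorm w <= rnorm (v - w).
Proof. by rewrite lerBlDr (le_trans _ (rnormD _ _)) // subrK. Qed.

Lemma rnormZ (V : normedModType C) (a : C) (v : V) : rnorm (a *: v) = rnorm a * rnorm v.
Proof. by apply: complexI; rewrite realcM -!rnormE normrZ. Qed.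

Lemma rnormM (a b : C) : rnorm (a * b) = rnorm a * rnorm b.
Proof. exact: rnormZ. Qed.

Lemma rnormR (x : R) : rnorm (x%:C%C : C) = `|x|.
Proof. by rewrite /rnorm normc_def /= expr0n addr0 sqrtr_sqr. Qed.

Lemma rnorm1 : rnorm (1 : C) = 1.
Proof. by rewrite -[1 in LHS]/(1%:C%C) rnormR normr1. Qed.

Lemma rnormV (a : C) : rnorm a^-1 = (rnorm a)^-1.
Proof.
have [->|a0] := eqVneq a 0; first by rewrite !(invr0, rnorm0).
have n0 : rnorm a != 0 by rewrite rnorm_eq0.
by apply: (mulfI n0); rewrite -rnormM !divff // rnorm1.
Qed.

Lemma rnormX (a : C) n : rnorm (a ^+ n) = rnorm a ^+ n.
Proof. by elim: n => [|n IH]; rewrite ?expr0 ?rnorm1 // !exprS rnormM IH. Qed.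

Lemma rnorm_nat n : rnorm (n%:R : C) = n%:R.
Proof. by rewrite -(rmorph_nat (real_complex R)) [LHS]rnormR ger0_norm. Qed.

Lemma rnormi : rnorm ('i%C : C) = 1.
Proof. by rewrite /rnorm normc_def /= expr0n expr1n add0r sqrtr1. Qed.

Lemma rnorm_sqr (z : C) : rnorm z ^+ 2 = complex.Re z ^+ 2 + complex.Im z ^+ 2.
Proof. by rewrite /rnorm normc_def /= sqr_sqrtr // addr_ge0 ?sqr_ge0. Qed.

Lemma ler_Re_rnorm (z : C) : `|complex.Re z| <= rnorm z.
Proof. by rewrite -lecR -rnormE normc_ge_Re. Qed.

Lemma ler_Im_rnorm (z : C) : `|complex.Im z| <= rnorm z.
Proof. by rewrite /rnorm normc_def /= -sqrtr_sqr ler_wsqrtr // lerDr sqr_ge0. Qed.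

Lemma rnorm_le_ReIm (z : C) : rnorm z <= `|complex.Re z| + `|complex.Im z|.
Proof.
rewrite [z in leLHS]complexE (le_trans (rnormD _ _)) // rnormM rnormi mul1r.
by rewrite !rnormR.
Qed.

Lemma ReD (z w : C) : complex.Re (z + w) = complex.Re z + complex.Re w.
Proof. by case: z w => [? ?] [? ?]. Qed.

Lemma ReN (z : C) : complex.Re (- z) = - complex.Re z.
Proof. by case: z. Qed.

Lemma ReMc (s : R) (z : C) : complex.Re (s%:C%C * z) = s * complex.Re z.
Proof. by case: z => a b; rewrite /= mul0r subr0. Qed.

Lemma Re_half (z : C) : complex.Re (z / 2) = complex.Re z / 2.
Proof. by rewrite {2}[z](splitr z) ReD; field. Qed.

End RealNorm.

Section Hol.
Variable R : realType.
Local Notation C := R[i].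

(** Complex differentiability at the single point [t], in epsilon form with real radii. By [holP] it
    agrees with [differentiable]. *)
Definition hol (q : C -> C) (t : C) := exists c : C, forall e : R, 0 < e ->
  exists2 d : R, 0 < d &
    forall h, rnorm h < d -> rnorm (q (t + h) - q t - c * h) <= e * rnorm h.

Lemma near0_rnormP (V : normedModType C) (P : V -> Prop) :
  (\forall h \near (0 : V), P h) <-> exists2 d : R, 0 < d & forall h, rnorm h < d -> P h.
Proof.
split.
  move=> /nbhs_ballP [e e0 He].
  have er : e = (complex.Re e)%:C%C by rewrite RRe_real // gtr0_real.
  exists (complex.Re e); first by move: e0; rewrite /= er ltcR.
  move=> h hd; apply: He; rewrite -ball_normE /ball_ /= sub0r normrN rnormE er.
  by rewrite ltcR.
move=> [d d0 H]; apply/nbhs_ballP; exists d%:C%C; first by rewrite /= ltcR.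
move=> h; rewrite -ball_normE /ball_ /= sub0r normrN rnormE ltcR; exact: H.
Qed.

Lemma near_rnormP (V : normedModType C) (x : V) (P : V -> Prop) :
  (\forall y \near x, P y) <->
  exists2 d : R, 0 < d & forall y, rnorm (y - x) < d -> P y.
Proof.
rewrite (near_shift 0 x) near0_rnormP subr0; split=> -[d d0 H]; exists d => //.
  by move=> y yd; have := H _ yd; rewrite /= subrK.
by move=> h hd /=; apply: H; rewrite addrK.
Qed.

Lemma differentiable_eps (V W : normedModType C) (f : V -> W) x :
  differentiable f x -> forall e : R, 0 < e -> exists2 d : R, 0 < d &
    forall h, rnorm h < d -> rnorm (f (x + h) - f x - 'd f x h) <= e * rnorm h.
Proof.
move=> /diff_locallyP[_ /eqaddoP H] e e0.
have {}H := H e%:C%C; move: H; rewrite ltcR => /(_ e0) /near0_rnormP[d d0 H].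
exists d => // h /H; rewrite /= !rnormE -realcM lecR.
by rewrite -[(_ - _) h]/(f (h + x) - (f x + 'd f x h)) [h + x]addrC opprD addrA.
Qed.

Lemma eps_differentiable (V W : normedModType C) (f : V -> W) (L : {linear V -> W}) x :
  continuous L -> (forall e : R, 0 < e -> exists2 d : R, 0 < d &
    forall h, rnorm h < d -> rnorm (f (x + h) - f x - L h) <= e * rnorm h) ->
  differentiable f x /\ 'd f x = L :> (V -> W).
Proof.
move=> cL H.
have E : f \o shift x = cst (f x) + L +o_ 0 id.
  apply/eqaddoP => e e0; have er : e = (complex.Re e)%:C%C by rewrite RRe_real // gtr0_real.
  rewrite er ltcR in e0; have [d d0 Hd] := H _ e0.
  apply/near0_rnormP; exists d => // h /Hd.
  rewrite /= !rnormE er -realcM lecR.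
  by rewrite -[(_ - _) h]/(f (h + x) - (f x + L h)) [h + x]addrC opprD addrA.
have dL : 'd f x = L :> (V -> W) by exact: diff_unique.
by split => //; apply/diff_locallyP; rewrite dL.
Qed.

Lemma holP (q : C -> C) t : hol q t <-> differentiable q t.
Proof.
split=> [[c H]|dq].
  have [] // := @eps_differentiable C C q ( *:%R c : C -> C) t; exact: scaler_continuous.
exists ('d q t 1) => e e0; have [d d0 H] := differentiable_eps dq e0.
exists d => // h /H.
suff -> : 'd q t 1 * h = 'd q t h by [].
by rewrite -[h in RHS]mulr1 -[h * 1]/(h *: 1) linearZ mulrC.
Qed.
End Hol.

(** * Goursat's theorem for trapezoid sums *)

Section Goursat.
Variable R : realType.
Local Notation C := R[i].

Lemma realc_half (s : R) : (s / 2)%:C%C = s%:C%C / 2 :> C.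
Proof. by rewrite [s in RHS](splitr s) realcD; field. Qed.

Section Mean.
Variable g : C -> C.

(** Trapezoid mean of [g] over the segment from [z] to [z + w] with 2^n equal steps. The recursion
    by halving makes the subdivision of loops an exact algebraic identity. *)
Fixpoint dmean (n : nat) (z w : C) : C :=
  if n is n'.+1 then (dmean n' z (w / 2) + dmean n' (z + w / 2) (w / 2)) / 2
  else (g z + g (z + w)) / 2.

(* [v * (difference of means)] and [u * (...)] are trapezoid sums, with 2 ^ n steps, of [g dz]
   along the sides of the parallelogram with corner z and edges u and v. *)
Definition dloop n (z u v : C) : C :=
  u * (dmean n z u - dmean n (z + v) u) + v * (dmean n (z + u) v - dmean n z v).

(** The inner edges of the four quarters are run through twice in opposite directions and cancel;
    halving the outer edges uses up one level of depth. *)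
Lemma dloopS n z u v : dloop n.+1 z u v =
  dloop n z (u / 2) (v / 2) + dloop n (z + u / 2) (u / 2) (v / 2)
  + dloop n (z + v / 2) (u / 2) (v / 2) + dloop n (z + u / 2 + v / 2) (u / 2) (v / 2).
Proof.
rewrite /dloop /=.
have -> : z + u / 2 + u / 2 = z + u by field.
have -> : z + v / 2 + v / 2 = z + v by field.
have -> : z + v / 2 + u / 2 = z + u / 2 + v / 2 by field.
have -> : z + u / 2 + v / 2 + v / 2 = z + v + u / 2 by field.
have -> : z + u / 2 + v / 2 + u / 2 = z + u + v / 2 by field.
by field.
Qed.

(** Trapezoid means are iterated midpoints. Applied below to discs and to half-planes. *)
Lemma dmean_ind (P : C -> Prop) :
  (forall x y, P x -> P y -> P ((x + y) / 2)) ->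
  forall n z w, (forall s : R, 0 <= s <= 1 -> P (g (z + s%:C%C * w))) -> P (dmean n z w).
Proof.
move=> cP; elim=> [|n IH] z w H /=.
  apply: cP; first by have := H 0; rewrite lexx ler01 /= mul0r addr0; apply.
  by have := H 1; rewrite lexx ler01 /= mul1r; apply.
apply: cP; apply: IH => s /andP[s0 s1].
  have -> : s%:C%C * (w / 2) = (s / 2)%:C%C * w by rewrite realc_half; field.
  by apply: H; lra.
have -> : z + w / 2 + s%:C%C * (w / 2) = z + ((1 + s) / 2)%:C%C * w.
  by rewrite realc_half realcD; field.
by apply: H; lra.
Qed.
End Mean.

Lemma dmean_affine (a b : C) n z w : dmean (fun x => a + b * x) n z w = a + b * (z + w / 2).
Proof. by elim: n z w => [|n IH] z w /=; rewrite ?IH; field. Qed.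

Lemma dmeanB (g h : C -> C) n z w :
  dmean (fun x => g x - h x) n z w = dmean g n z w - dmean h n z w.
Proof. by elim: n z w => [|n IH] z w /=; rewrite ?IH; field. Qed.

Lemma dmean_bound (g : C -> C) (M : R) n z w :
  (forall s : R, 0 <= s <= 1 -> rnorm (g (z + s%:C%C * w)) <= M) -> rnorm (dmean g n z w) <= M.
Proof.
apply: (@dmean_ind g (fun x => rnorm x <= M)) => x y xM yM.
rewrite rnormM rnormV rnorm_nat.
by rewrite ler_pdivrMr // (le_trans (rnormD _ _)) // mulrDr mulr1 lerD.
Qed.

(** The trapezoid rule is exact for affine functions, so their loop sums vanish and only the
    distance of [g] to an affine function counts. The bound is uniform in the depth [n]. *)
Lemma dloop_bound (g : C -> C) (a b : C) (M : R) n z u v :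
  (forall s t : R, 0 <= s <= 1 -> 0 <= t <= 1 ->
     rnorm (g (z + s%:C%C * u + t%:C%C * v) - (a + b * (z + s%:C%C * u + t%:C%C * v))) <= M) ->
  rnorm (dloop g n z u v) <= 2 * M * (rnorm u + rnorm v).
Proof.
move=> H; pose h x := g x - (a + b * x).
have -> : dloop g n z u v = dloop h n z u v.
  by rewrite /dloop !dmeanB !dmean_affine; field.
have I0 : 0 <= (0 : R) <= 1 by rewrite lexx ler01.
have I1 : 0 <= (1 : R) <= 1 by rewrite lexx ler01.
have c1 : (1%:C%C : C) = 1 by [].
have b1 : rnorm (dmean h n z u) <= M.
  by apply: dmean_bound => s Hs; have := H s 0 Hs I0; rewrite mul0r addr0.
have b2 : rnorm (dmean h n (z + v) u) <= M.
  by apply: dmean_bound => s Hs; have := H s 1 Hs I1; rewrite mul1r [z + _ + v]addrAC.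
have b3 : rnorm (dmean h n (z + u) v) <= M.
  by apply: dmean_bound => s Hs; have := H 1 s I1 Hs; rewrite mul1r.
have b4 : rnorm (dmean h n z v) <= M.
  by apply: dmean_bound => s Hs; have := H 0 s I0 Hs; rewrite mul0r addr0.
rewrite /dloop (le_trans (rnormD _ _)) // !rnormM.
have P (x y : C) : rnorm x <= M -> rnorm y <= M -> rnorm (x - y) <= 2 * M.
  by move=> xM yM; rewrite (le_trans (rnormB _ _)) // mulrDl mul1r lerD.
rewrite mulrDr lerD // [leRHS]mulrC ler_wpM2l ?rnorm_ge0 ?P //.
Qed.

End Goursat.

(** The intervals from [a k] to [a k + 2^-k] are nested, and the supremum of their left ends lies in
    all of them. *)
Lemma nested_dyadic (R : realType) (a : nat -> R) :
  (forall k, a k <= a k.+1 <= a k + 2^-1 ^+ k.+1) ->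
  exists S, forall k, a k <= S <= a k + 2^-1 ^+ k.
Proof.
move=> H.
have up j k : (j <= k)%N -> a j <= a k.
  move=> /subnKC <-; elim: (k - j)%N => [|m IH]; first by rewrite addn0.
  by rewrite addnS (le_trans IH) //; case/andP: (H (j + m)%N).
have dn j k : (j <= k)%N -> a k + 2^-1 ^+ k <= a j + 2^-1 ^+ j.
  move=> /subnKC <-; elim: (k - j)%N => [|m IH]; first by rewrite addn0.
  rewrite addnS (le_trans _ IH) //; case/andP: (H (j + m)%N) => _.
  rewrite !exprS; set x := _ ^+ _; lra.
have h0 k : 0 <= (2^-1 : R) ^+ k by rewrite exprn_ge0 // invr_ge0.
have ub k : ubound (range a) (a k + 2^-1 ^+ k).
  move=> _ [j _ <-]; have [jk|/ltnW kj] := leqP j k.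
    by rewrite (le_trans (up _ _ jk)) // lerDl.
  by rewrite (le_trans _ (dn _ _ kj)) // lerDl.
exists (sup (range a)) => k; apply/andP; split.
  by apply: ub_le_sup; [exists (a 0%N + 2^-1 ^+ 0); exact: ub|exists k].
by apply: ge_sup => //; exists (a 0%N); exists 0%N.
Qed.

Section GoursatThm.
Variable R : realType.
Local Notation C := R[i].
Lemma realcN (x : R) : (- x)%:C%C = - x%:C%C :> C.
Proof. exact: (rmorphN (real_complex R)). Qed.

Lemma real_half_exp k : ((2^-1 : R) ^+ k)%:C%C = 2^-1 ^+ k :> C.
Proof.
elim: k => [|k IH]; rewrite ?expr0 // !exprSr -IH.
by rewrite -[_ * 2^-1]/(_ / 2) realc_half.
Qed.

(* A loop with sum larger than kappa for infinitely many n has a quarter with sum larger than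
   kappa / 4 for infinitely many n; the differentiability of g at the limit of the nested
   quarters contradicts this. *)
Lemma discrete_goursat (g : C -> C) (z u v : C) :
  (forall s t : R, 0 <= s <= 1 -> 0 <= t <= 1 -> hol g (z + s%:C%C * u + t%:C%C * v)) ->
  forall kappa : R, 0 < kappa ->
  exists N : nat, forall n, (N <= n)%N -> rnorm (dloop g n z u v) <= kappa.
Proof.
move=> Hg kappa kappa0; apply: contrapT => nN.
pose pt (p : R * R) := z + p.1%:C%C * u + p.2%:C%C * v.
pose h k : R := 2^-1 ^+ k.
have h0 k : 0 < h k by rewrite exprn_gt0 // invr_gt0.
have hS k : h k = 2 * h k.+1 by rewrite /h exprS; field.
pose hc k : C := 2^-1 ^+ k.
pose bad (p : R * R) k := forall N : nat, exists2 n, (N <= n)%N &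
  kappa * h k ^+ 2 < rnorm (dloop g n (pt p) (hc k * u) (hc k * v)).
have bad0 : bad (0, 0) 0%N.
  move=> N; apply: contrapT => H; apply: nN; exists N => n Nn.
  rewrite leNgt; apply/negP => bn; apply: H; exists n => //.
  by rewrite /pt /h /hc !expr0 expr1n mulr1 !mul1r !mul0r !addr0.
(* Badness of [x] is a premise inside the existential, so that [choice] yields a total selection of
   quarters. *)
have step (x : (R * R) * nat) : exists y : R * R, bad x.1 x.2 ->
  [/\ x.1.1 <= y.1 <= x.1.1 + h x.2.+1, x.1.2 <= y.2 <= x.1.2 + h x.2.+1 & bad y x.2.+1].
  case: x => -[s t] k /=; apply: contrapT => nE.
  have nb (i j : bool) : exists N, forall n, (N <= n)%N ->
      rnorm (dloop g n (pt (s + i%:R * h k.+1, t + j%:R * h k.+1)) (hc k.+1 * u) (hc k.+1 * v))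
        <= kappa * h k.+1 ^+ 2.
    apply: contrapT => nEE; apply: nE; exists (s + i%:R * h k.+1, t + j%:R * h k.+1).
    move=> _; split=> /=; [have := h0 k.+1; case: i nEE => _ /=; lra| |].
      by have := h0 k.+1; case: j nEE => _ /=; lra.
    move=> N; apply: contrapT => H; apply: nEE; exists N => n Nn.
    by rewrite leNgt; apply/negP => bn; apply: H; exists n.
  have [[N1 H1] [N2 H2] [N3 H3] [N4 H4]] := And4 (nb false false) (nb true false)
    (nb false true) (nb true true).
  (* The successor pays for the level of depth lost in [dloopS]: the remaining [n] is still beyond
     all four bounds. The witness [(s, t)] is arbitrary, since badness is refuted. *)
  apply: nE; exists (s, t) => /(_ (maxn (maxn N1 N2) (maxn N3 N4)).+1) [[//|n]].
  rewrite ltnS !geq_max => /andP[/andP[n1 n2] /andP[n3 n4]].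
  rewrite ltNge => /negP; case.
  have E (w : C) : hc k * w / 2 = hc k.+1 * w by rewrite /hc exprS; field.
  rewrite dloopS !E.
  have := H1 _ n1; have := H2 _ n2; have := H3 _ n3; have := H4 _ n4.
  have hr : (h k.+1)%:C%C = hc k.+1 by rewrite /h /hc real_half_exp.
  have P1 : pt (s + 1 * h k.+1, t + 0 * h k.+1) = pt (s, t) + hc k.+1 * u.
    by rewrite /pt /= !realcD mul1r mul0r hr; ring.
  have P2 : pt (s + 0 * h k.+1, t + 1 * h k.+1) = pt (s, t) + hc k.+1 * v.
    by rewrite /pt /= !realcD mul1r mul0r hr; ring.
  have P3 : pt (s + 1 * h k.+1, t + 1 * h k.+1) = pt (s, t) + hc k.+1 * u + hc k.+1 * v.
    by rewrite /pt /= !realcD !mul1r hr; ring.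
  have P0 : pt (s + 0 * h k.+1, t + 0 * h k.+1) = pt (s, t) by rewrite !mul0r !addr0.
  rewrite /= P0 P1 P2 P3 (hS k) => b4 b3 b2 b1.
  set w1 := dloop _ _ (pt (s, t)) _ _ in b1 *; set w2 := dloop _ _ _ _ _ in b2 *.
  set w3 := dloop _ _ _ _ _ in b3 *; set w4 := dloop _ _ _ _ _ in b4 *.
  have := rnormD (w1 + w2 + w3) w4; have := rnormD (w1 + w2) w3; have := rnormD w1 w2.
  by rewrite exprMn; lra.
have [F HF] := choice step.
pose p := fix p k := if k is k'.+1 then F (p k', k') else (0, 0).
have pbad k : bad (p k) k by elim: k => // k /(HF (p k, k)) [].
have [S HS] : exists S, forall k, (p k).1 <= S <= (p k).1 + h k.
  by apply: nested_dyadic => k; have [] := HF (p k, k) (pbad k).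
have [T HT] : exists T, forall k, (p k).2 <= T <= (p k).2 + h k.
  by apply: nested_dyadic => k; have [] := HF (p k, k) (pbad k).
have S01 : 0 <= S <= 1 by have := HS 0%N; rewrite /h expr0 /= add0r.
have T01 : 0 <= T <= 1 by have := HT 0%N; rewrite /h expr0 /= add0r.
have [c Hc] := Hg S T S01 T01.
set x0 := z + _ + _ in Hc.
pose D := rnorm u + rnorm v.
have D0 : 0 <= D by rewrite addr_ge0 ?rnorm_ge0.
(* At scale [h k], comparison with the tangent of [g] at the limit point bounds the loop sum by
   [2 * e * (h k * D) ^+ 2], which is at most [kappa * h k ^+ 2]. The summand 1 covers the case
   [D = 0]. *)
pose e := kappa / (2 * (D + 1) ^+ 2).
have e0 : 0 < e by rewrite divr_gt0 // mulr_gt0 // exprn_gt0 //; lra.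
have [d d0 Hd] := Hc e e0.
have [k hk] : exists k, h k * (D + 1) < d.
  have q0 : 0 <= (D + 1) / d by rewrite divr_ge0 ?(ltW d0) //; lra.
  exists (Num.Def.archi_bound ((D + 1) / d)); set k := Num.Def.archi_bound _.
  rewrite /h exprVn mulrC ltr_pdivrMr ?exprn_gt0 // mulrC -ltr_pdivrMr //.
  by rewrite (lt_trans (archi_boundP q0)) // -natrX ltr_nat ltn_expl.
have [n _] := pbad k 0%N.
rewrite ltNge => /negP; apply.
apply: (@le_trans _ _ (2 * (e * (h k * D)) * (rnorm (hc k * u) + rnorm (hc k * v)))).
  apply: (@dloop_bound _ g (g x0 - c * x0) c) => s t s01 t01.
  set x := _ + _ + _.
  have dx : rnorm (x - x0) <= h k * D.
    have -> : x - x0 = ((p k).1 + s * h k - S)%:C%C * u + ((p k).2 + t * h k - T)%:C%C * v.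
      have hr : (h k)%:C%C = hc k by rewrite /h /hc real_half_exp.
      by rewrite /x /x0 /pt !(realcD, realcM, realcN) hr; ring.
    rewrite (le_trans (rnormD _ _)) // !rnormM !rnormR mulrDr lerD //.
      apply: ler_wpM2r; first exact: rnorm_ge0.
      have := HS k; have := h0 k; rewrite ler_norml; nra.
    apply: ler_wpM2r; first exact: rnorm_ge0.
    have := HT k; have := h0 k; rewrite ler_norml; nra.
  have := Hd (x - x0); rewrite [x0 + _]addrC subrK => Hx.
  have -> : g x - (g x0 - c * x0 + c * x) = g x - g x0 - c * (x - x0) by ring.
  rewrite (le_trans (Hx _)) ?ler_wpM2l ?(ltW e0) // (le_lt_trans dx) //.
  by rewrite (le_lt_trans _ hk) // ler_wpM2l ?(ltW (h0 k)) //; lra.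
have rhc : rnorm (hc k) = h k by rewrite /hc -real_half_exp rnormR gtr0_norm.
rewrite !rnormM rhc -mulrDr -/D.
have -> : 2 * (e * (h k * D)) * (h k * D) = h k ^+ 2 * (2 * e * D ^+ 2) by ring.
rewrite mulrC ler_wpM2r ?sqr_ge0 //.
rewrite /e.
have -> : 2 * (kappa / (2 * (D + 1) ^+ 2)) * D ^+ 2 = kappa * (D ^+ 2 / (D + 1) ^+ 2).
  by field; lra.
rewrite ger_pMr // ler_pdivrMr ?exprn_gt0 //; last lra.
by rewrite mul1r; nra.
Qed.
End GoursatThm.

(** * The maximum principle *)

Section Exp.
Variable R : realType.
Local Notation C := R[i].

(** The complex exponential. It carries vertical segments of length 2 pi onto circles about 0, which
    brings circles within reach of loops along parallelograms. *)
Definition cexp (z : C) : C :=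
  (expR (complex.Re z))%:C%C * (cos (complex.Im z) +i* sin (complex.Im z))%C.

Lemma cexpD z w : cexp (z + w) = cexp z * cexp w.
Proof.
case: z w => [a b] [c d]; rewrite /cexp /= expRD realcM.
have -> : (cos (b + d) +i* sin (b + d))%C = (cos b +i* sin b)%C * (cos d +i* sin d)%C.
  rewrite cosD sinD; apply/eqP; rewrite eq_complex /= eqxx [X in _ == X]addrC /=.
  by apply/eqP; congr (_ + _); rewrite mulrC.
by ring.
Qed.

Lemma rnorm_cexp z : rnorm (cexp z) = expR (complex.Re z).
Proof.
rewrite /cexp rnormM rnormR gtr0_norm ?expR_gt0 // /rnorm normc_def /=.
by rewrite cos2Dsin2 sqrtr1 mulr1.
Qed.

Lemma cexp_periodic z : cexp (z + (0 +i* (pi *+ 2))%C) = cexp z.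
Proof.
by rewrite cexpD /cexp /= expR0 cos2pi sin2pi mul1r mulr1.
Qed.

Lemma is_derive_eps (f : R -> R) (x l : R) : is_derive x 1 f l ->
  forall e : R, 0 < e -> exists2 d : R, 0 < d &
    forall h, `|h| < d -> `|f (x + h) - f x - h * l| <= e * `|h|.
Proof.
move=> H e e0; have D : derivable f x 1 by [].
have /derivable_nbhs /eqaddoP /(_ e e0) := D.
move=> /nbhs_ballP[d d0 Hd]; exists d => // h hd.
have := Hd h; rewrite /ball /= sub0r normrN => /(_ hd).
rewrite /= -[(_ - _) h]/(f (h *: 1 + x) - (f x + h *: 'D_1 f x)) derive_val.
by rewrite [h *: 1]mulr1 [h + x]addrC opprD addrA.
Qed.

(** The addition formula reduces the claim to the point 0, where it follows from the real
    derivatives of [expR], [cos] and [sin]. *)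
Lemma hol_cexp z : hol cexp z.
Proof.
exists (cexp z) => e e0.
suff [d d0 H] : exists2 d : R, 0 < d &
    forall h, rnorm h < d -> rnorm (cexp h - 1 - h) <= e / expR (complex.Re z) * rnorm h.
  exists d => // h /H Hh; rewrite cexpD.
  have -> : cexp z * cexp h - cexp z - cexp z * h = cexp z * (cexp h - 1 - h) by ring.
  by rewrite rnormM rnorm_cexp mulrC -ler_pdivlMr ?expR_gt0 // mulrAC.
have := divr_gt0 e0 (expR_gt0 (complex.Re z)).
move: (e / _) => {e0} e e0.
(* The error terms below add up to at most [9 * e1 * r]. The bound 1 keeps [r] below 1 and hence
   [expR a] below 3. *)
pose e1 := Num.min (e / 16) 1.
have e10 : 0 < e1 by rewrite lt_min ltr01 andbT; lra.
have e18 : e1 <= e / 16 by rewrite ge_min lexx.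
have e11 : e1 <= 1 by rewrite ge_min lexx orbT.
clearbody e1.
have [d1 d10 H1] := is_derive_eps (is_derive_expR (0 : R)) e10.
have [d2 d20 H2] := is_derive_eps (is_derive_cos (0 : R)) e10.
have [d3 d30 H3] := is_derive_eps (is_derive_sin (0 : R)) e10.
exists (Num.min (Num.min d1 d2) (Num.min d3 e1)); first by rewrite !lt_min d10 d20 d30 e10.
case=> a b; rewrite !lt_min => /andP[/andP[n1 n2] /andP[n3 n4]].
set r := rnorm _ in n1 n2 n3 n4 *.
have ar : `|a| <= r := ler_Re_rnorm (a +i* b)%C.
have br : `|b| <= r := ler_Im_rnorm (a +i* b)%C.
have A1 := H1 a (le_lt_trans ar n1); rewrite add0r expR0 mulr1 in A1.
have A2 := H2 b (le_lt_trans br n2); rewrite add0r sin0 cos0 oppr0 mulr0 subr0 in A2.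
have A3 := H3 b (le_lt_trans br n3); rewrite add0r sin0 cos0 mulr1 subr0 in A3.
have r0 : 0 <= r := rnorm_ge0 _.
have B1 : `|expR a - 1 - a| <= e1 * r by rewrite (le_trans A1) // ler_wpM2l // ltW.
have B2 : `|cos b - 1| <= e1 * r by rewrite (le_trans A2) // ler_wpM2l // ltW.
have B3 : `|sin b - b| <= e1 * r by rewrite (le_trans A3) // ler_wpM2l // ltW.
have E1 : `|expR a - 1| <= 2 * r.
  rewrite -[expR a - 1](subrK a) (le_trans (ler_normD _ _)) //.
  by have := ler_wpM2r r0 e11; lra.
have E3 : `|expR a| <= 3.
  rewrite -[expR a](subrK 1) (le_trans (ler_normD _ _)) // normr1; lra.
have P1 : `|expR a * (cos b - 1)| <= 3 * (e1 * r) by rewrite normrM ler_pM.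
have P2 : `|expR a * (sin b - b)| <= 3 * (e1 * r) by rewrite normrM ler_pM.
have P3 : `|(expR a - 1) * b| <= 2 * r * e1.
  by rewrite normrM ler_pM // (le_trans br) // ltW.
have T : 16 * (e1 * r) <= e * r by rewrite mulrA ler_wpM2r //; lra.
rewrite /cexp /= (le_trans (rnorm_le_ReIm _)) //= !mul0r subr0 addr0 oppr0 addr0.
have -> : expR a * cos b - 1 - a = (expR a - 1 - a) + expR a * (cos b - 1) by ring.
have -> : expR a * sin b - b = expR a * (sin b - b) + (expR a - 1) * b by ring.
have er0 : 0 <= e1 * r by rewrite mulr_ge0 // ltW.
have := ler_normD (expR a - 1 - a) (expR a * (cos b - 1)).
have := ler_normD (expR a * (sin b - b)) ((expR a - 1) * b).
lra.
Qed.

Lemma hol_cont (q : C -> C) t : hol q t ->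
  forall e : R, 0 < e -> exists2 d : R, 0 < d &
    forall h, rnorm h < d -> rnorm (q (t + h) - q t) <= e.
Proof.
move=> [c H] e e0; have [d d0 Hd] := H 1 ltr01.
have c1 : 0 < rnorm c + 1 by have := rnorm_ge0 c; lra.
exists (Num.min d (e / (rnorm c + 1))); first by rewrite lt_min d0 divr_gt0.
move=> h; rewrite lt_min ltr_pdivlMr // => /andP[hd he].
rewrite -[q (t + h) - q t](subrK (c * h)) (le_trans (rnormD _ _)) // rnormM.
have := Hd h hd; lra.
Qed.

Lemma hol_comp (q E : C -> C) t : hol E t -> hol q (E t) -> hol (q \o E) t.
Proof. by move=> /holP dE /holP dq; apply/holP; exact: differentiable_comp dE dq. Qed.

(* The mean value of q over the circles of radius exp x does not depend on x: this is
   Cauchy's theorem for [q \o cexp] on a rectangle of height 2 pi. *)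
Lemma max_principle_Re (q : C -> C) (r : R) : 0 < r ->
  (forall t, 0 < rnorm t <= r -> hol q t) ->
  (forall e : R, 0 < e -> exists2 d : R, 0 < d &
     forall t, rnorm t < d -> rnorm (q t - q 0) <= e) ->
  forall m : R, 0 < m ->
  exists2 t, rnorm t = r & complex.Re (q 0) - m <= complex.Re (q t).
Proof.
move=> r0 hq cq m m0; apply: contrapT => nE.
have m2 : 0 < m / 2 by lra.
have [d d0 Hd] := cq _ m2.
(* On the circle of radius [r1] the real part of [q] is at least [Re (q 0) - m / 2]; on that of
   radius [r] it is, by contradiction, below [Re (q 0) - m]. *)
pose r1 := Num.min (d / 2) r.
have r10 : 0 < r1 by rewrite lt_min r0 andbT; lra.
have r1d : r1 < d by rewrite gt_min; apply/orP; left; lra.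
have r1r : r1 <= r by rewrite ge_min lexx orbT.
(* [cexp] maps the rectangle with corner [z] and edges [u] and [v] onto the annulus between the two
   circles; the contributions of the two horizontal sides cancel by periodicity. *)
pose z : C := (ln r1)%:C%C; pose u : C := (ln r - ln r1)%:C%C.
pose v : C := (0 +i* (pi *+ 2))%C.
have lnr : ln r1 <= ln r by rewrite ler_ln.
pose g := q \o cexp.
have gv x : g (x + v) = g x by rewrite /g /= cexp_periodic.
have dmv n : dmean g n (z + v) u = dmean g n z u.
  elim: n z u => [|n IH] z u /=; first by rewrite addrAC !gv.
  by rewrite addrAC !IH.
have hg (s t : R) : 0 <= s <= 1 -> 0 <= t <= 1 -> hol g (z + s%:C%C * u + t%:C%C * v).
  move=> /andP[s0 s1] t01; apply: hol_comp; first exact: hol_cexp.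
  apply: hq; rewrite rnorm_cexp expR_gt0 !ReD !ReMc /= mulr0 addr0.
  by rewrite -[leRHS]lnK ?posrE // ler_expR; nra.
(* The means over the vertical sides differ by at least [m / 2], so the loop sum is at least
   [pi * m] in modulus, which exceeds [kappa]. *)
pose kappa := pi * m / 4.
have k0 : 0 < kappa by rewrite divr_gt0 // mulr_gt0 // pi_gt0.
have [N HN] := discrete_goursat hg k0.
have := HN N (leqnn N); rewrite /dloop dmv subrr mulr0 add0r rnormM.
have -> : rnorm v = pi *+ 2.
  by rewrite /rnorm normc_def /= expr0n add0r sqrtr_sqr ger0_norm // mulrn_wge0 // pi_ge0.
have H1 : complex.Re (dmean g N (z + u) v) <= complex.Re (q 0) - m.
  apply: (@dmean_ind _ g (fun x => complex.Re x <= complex.Re (q 0) - m)).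
    by move=> x y xm ym; rewrite Re_half ReD; lra.
  move=> s _; rewrite leNgt; apply/negP => /ltW bs; apply: nE.
  exists (cexp (z + u + s%:C%C * v)) => //.
  rewrite rnorm_cexp !ReD ReMc /= mulr0 addr0 addrC subrK.
  by rewrite lnK ?posrE.
have H2 : complex.Re (q 0) - m / 2 <= complex.Re (dmean g N z v).
  apply: (@dmean_ind _ g (fun x => complex.Re (q 0) - m / 2 <= complex.Re x)).
    by move=> x y xm ym; rewrite Re_half ReD; lra.
  move=> s _.
  have /Hd : rnorm (cexp (z + s%:C%C * v)) < d.
    by rewrite rnorm_cexp !ReD ReMc /= mulr0 addr0 lnK ?posrE.
  move=> /(le_trans (ler_Re_rnorm _)).
  rewrite ler_norml ReD ReN => /andP[+ _]; rewrite /g /=; lra.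
have D : m / 2 <= rnorm (dmean g N (z + u) v - dmean g N z v).
  rewrite rdistC (le_trans _ (ler_Re_rnorm _)) // (le_trans _ (ler_norm _)) //.
  by rewrite ReD ReN; lra.
have p0 := pi_gt0 R; rewrite /kappa mulr2n => bad.
have := ler_wpM2l (ltW p0) D; have := mulr_gt0 p0 m0; lra.
Qed.
End Exp.

(** * Maximum modulus and Schwarz estimates off a zero set *)

Section Schwarz.
Variable R : realType.
Local Notation C := R[i].

Lemma hol_near_eq (q g : C -> C) t (d : R) : 0 < d ->
  (forall h, rnorm h < d -> q (t + h) = g (t + h)) -> hol g t -> hol q t.
Proof.
move=> d0 E [c H]; exists c => e /H[d1 d10 H1].
exists (Num.min d d1); first by rewrite lt_min d0.
move=> h; rewrite lt_min => /andP[hd hd1]; rewrite E //.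
by rewrite -[q t](congr1 q (addr0 t)) E ?rnorm0 // addr0 H1.
Qed.

Lemma hol_shift (q : C -> C) a t : hol q (a + t) -> hol (fun x => q (a + x)) t.
Proof. by move=> [c H]; exists c => e /H[d d0 Hd]; exists d => // h hd; rewrite addrA Hd. Qed.

Lemma differentiable_pow (f : C -> C) t n :
  differentiable f t -> differentiable (fun x => f x ^+ n) t.
Proof.
move=> df; elim: n => [|n IH].
  by rewrite (_ : (fun _ => _) = cst 1) //; apply/funext => x; rewrite expr0.
rewrite (_ : (fun _ => _) = fun x => f x * f x ^+ n); first exact: differentiableM.
by apply/funext => x; rewrite exprS.
Qed.

(** After multiplication by a constant of modulus 1 the value at 0 is real and positive, and the
    principle for real parts applies. *)
Lemma max_modulus (q : C -> C) (r : R) : 0 < r ->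
  (forall t, rnorm t <= r -> hol q t) ->
  forall m : R, 0 < m -> exists2 t, rnorm t = r & rnorm (q 0) - m <= rnorm (q t).
Proof.
move=> r0 hq m m0.
have [q00|q00] := eqVneq (q 0) 0.
  exists r%:C%C; first by rewrite rnormR gtr0_norm.
  by rewrite q00 rnorm0 sub0r (le_trans _ (rnorm_ge0 _)) // oppr_le0 ltW.
pose a : C := (rnorm (q 0))%:C%C / q 0.
have a1 : rnorm a = 1.
  by rewrite rnormM rnormV rnormR ger0_norm ?rnorm_ge0 // divff // rnorm_eq0.
have qh t : rnorm t <= r -> hol (fun t => a * q t) t.
  move=> /hq/holP h; apply/holP; apply: differentiableM => //.
have [|e e0|t tr Ht] := @max_principle_Re _ (fun t => a * q t) r r0 _ _ m m0.
- by move=> t /andP[_ /qh].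
- have h0 : hol (fun t => a * q t) 0 by apply: qh; rewrite rnorm0 ltW.
  by have [d d0 H] := hol_cont h0 e0; exists d => // t /H; rewrite add0r.
exists t => //; rewrite -[leRHS]mul1r -a1 -rnormM.
apply: (le_trans _ (le_trans (ler_norm _) (ler_Re_rnorm _))).
by apply: le_trans Ht; rewrite /a divfK.
Qed.

(** If [x] exceeded [y], the quotient of the n-th powers would grow at least linearly by Bernoulli's
    inequality and pass [b / a]. This removes constant factors from estimates between powers. *)
Lemma ler_exp_limit (x y a b : R) : 0 <= x -> 0 <= y -> 0 < a ->
  (forall n, x ^+ n * a <= y ^+ n * b) -> x <= y.
Proof.
move=> x0 y0 a0 H; rewrite leNgt; apply/negP => yx.
have {}x0 : 0 < x by exact: le_lt_trans yx.
pose k := (x - y) / x.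
have k0 : 0 < k by rewrite divr_gt0 // subr_gt0.
have b0 : 0 < b by have := H 0%N; rewrite !expr0 !mul1r; exact: lt_le_trans.
have B n : 1 + n%:R * k <= (1 + k) ^+ n.
  elim: n => [|n IH]; first by rewrite mul0r addr0 expr0.
  rewrite exprS -natr1; have : 0 <= n%:R * k by rewrite mulr_ge0 // ltW.
  move: IH; set p := (1 + k) ^+ n; set q := n%:R * k => IH q0.
  have := ler_wpM2l (ltW k0) IH; have := mulr_ge0 (ltW k0) q0.
  have -> : (n%:R + 1) * k = q + k by rewrite mulrDl mul1r.
  lra.
have yk : y * (1 + k) <= x.
  rewrite /k -ler_pdivlMr; last by rewrite addr_gt0 // divr_gt0 // subr_gt0.
  rewrite ler_pdivlMr; last by rewrite addr_gt0 // divr_gt0 // subr_gt0.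
  have -> : y * (1 + (x - y) / x) = x - (x - y) ^+ 2 / x by field; lra.
  by rewrite gerBl divr_ge0 ?sqr_ge0 // ltW.
have [y00|yn0] := eqVneq y 0.
  by have := H 1%N; rewrite y00 !expr1 mul0r leNgt mulr_gt0.
have {}y0 : 0 < y by rewrite lt_def yn0.
have Hn n : (1 + n%:R * k) * a <= b.
  have := H n; rewrite -ler_pdivrMl ?exprn_gt0 //; apply: le_trans.
  rewrite [leRHS]mulrA (ler_pM2r a0) (le_trans (B n)) // ler_pdivlMl ?exprn_gt0 //.
  rewrite -exprMn lerXn2r ?nnegrE ?(ltW x0) //.
  by rewrite mulr_ge0 // ?(ltW y0) // addr_ge0 // ltW.
have q0 : 0 <= b / (k * a) by rewrite ltW // divr_gt0 // mulr_gt0.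
have := archi_boundP q0; set n := Num.Def.archi_bound _.
clearbody n; rewrite (ltr_pdivrMr _ _ (mulr_gt0 k0 a0)) [X in _ < X]mulrA => Hb.
have := Hn n; lra.
Qed.

(* [gam ^+ 2] tames the possible bad behaviour of the bounded function B on the zero set of
   gam; taking high powers of B then makes the factor [gam ^+ 2] irrelevant. *)
Lemma max_modulus_off_zeros (B gam : C -> C) (r r0 M M' G : R) : 0 < r < r0 -> 0 <= M ->
  (forall t, rnorm t < r0 -> hol gam t) ->
  (forall t, rnorm t < r0 -> rnorm (gam t) <= G) ->
  (forall t, rnorm t < r0 -> gam t != 0 -> hol B t) ->
  (forall t, rnorm t < r0 -> gam t != 0 -> rnorm (B t) <= M') ->
  (forall t, rnorm t = r -> gam t != 0 -> rnorm (B t) <= M) ->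
  gam 0 != 0 -> rnorm (B 0) <= M.
Proof.
move=> /andP[r_gt0 rr0] M0 hgam bgam hB bB bBr g0.
have r00 : 0 < r0 by exact: lt_trans rr0.
have G0 : 0 <= G by apply: le_trans (bgam 0 _); rewrite ?rnorm_ge0 ?rnorm0.
have M'0 : 0 <= M' by apply: le_trans (bB 0 _ g0); rewrite ?rnorm_ge0 ?rnorm0.
apply: (@ler_exp_limit _ _ (rnorm (gam 0) ^+ 2) (G ^+ 2)) => //; first exact: rnorm_ge0.
  by rewrite exprn_gt0 // rnorm_gt0.
move=> n; pose q t := B t ^+ n * gam t ^+ 2.
have hq t : rnorm t < r0 -> hol q t.
  move=> tr; have [gt|gt] := eqVneq (gam t) 0; last first.
    have /holP dB := hB t tr gt; have /holP dg := hgam t tr.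
    by apply/holP; apply: differentiableM; exact: differentiable_pow.
  (* At a zero of [gam] the factor [gam ^+ 2] is of second order, and [B] is bounded off the zeros.
     So [q] is at most [K * |h|^2] there and has derivative 0. *)
  exists 0 => e e0; have [c Hc] := hgam t tr; have [d d0 Hd] := Hc 1 ltr01.
  pose K := M' ^+ n * (rnorm c + 1) ^+ 2 + 1.
  have c1 : 0 <= rnorm c + 1 by rewrite addr_ge0 ?rnorm_ge0.
  have K0 : 0 < K by rewrite /K ltr_wpDl // mulr_ge0 ?exprn_ge0.
  exists (Num.min d (Num.min (r0 - rnorm t) (e / K))).
    by rewrite !lt_min d0 subr_gt0 tr divr_gt0.
  move=> h; rewrite !lt_min => /and3P[hd hr he].
  rewrite mul0r subr0 /q gt expr0n /= mulr0 subr0.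
  have [->|gh] := eqVneq (gam (t + h)) 0.
    by rewrite expr0n mulr0 rnorm0 mulr_ge0 ?rnorm_ge0 // ltW.
  have thr : rnorm (t + h) < r0 by rewrite (le_lt_trans (rnormD _ _)) // -ltrBrDl.
  have b1 := bB _ thr gh.
  have b2 : rnorm (gam (t + h)) <= (rnorm c + 1) * rnorm h.
    have := Hd h hd; rewrite gt subr0 => Hh.
    rewrite -[gam _](subrK (c * h)) (le_trans (rnormD _ _)) // rnormM; lra.
  rewrite rnormM !rnormX; apply: (@le_trans _ _ (M' ^+ n * ((rnorm c + 1) * rnorm h) ^+ 2)).
    by apply: ler_pM; rewrite ?exprn_ge0 ?rnorm_ge0 //
      lerXn2r ?nnegrE ?rnorm_ge0 ?mulr_ge0 ?rnorm_ge0.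
  rewrite exprMn mulrA expr2 [_ * (rnorm h * _)]mulrA ler_wpM2r ?rnorm_ge0 //.
  apply: (@le_trans _ _ (K * rnorm h)); first by rewrite ler_wpM2r ?rnorm_ge0 // /K lerDl.
  by rewrite mulrC -ler_pdivlMr // ltW.
rewrite leNgt; apply/negP => lt.
have {}lt : 0 < rnorm (B 0) ^+ n * rnorm (gam 0) ^+ 2 - M ^+ n * G ^+ 2 by rewrite subr_gt0.
have m0 : 0 < (rnorm (B 0) ^+ n * rnorm (gam 0) ^+ 2 - M ^+ n * G ^+ 2) / 2 by lra.
have hqr t : rnorm t <= r -> hol q t by move=> tr; apply: hq; exact: le_lt_trans rr0.
have [t tr] := max_modulus r_gt0 hqr m0.
rewrite /q !rnormM !rnormX.
have tr0 : rnorm t < r0 by rewrite tr.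
suff : rnorm (B t) ^+ n * rnorm (gam t) ^+ 2 <= M ^+ n * G ^+ 2 by lra.
have [->|gt] := eqVneq (gam t) 0.
  by rewrite rnorm0 expr0n mulr0 mulr_ge0 ?exprn_ge0.
by apply: ler_pM; rewrite ?exprn_ge0 ?rnorm_ge0 // lerXn2r ?nnegrE ?rnorm_ge0 ?bBr ?bgam.
Qed.

(* The maximum principle for (f t - f 0) / t on a disc centred at 1. *)
Lemma schwarz_off_zeros (f gam : C -> C) (rho M G : R) : 1 <= rho ->
  (forall t, rnorm t < 4 * rho -> hol gam t) ->
  (forall t, rnorm t < 4 * rho -> rnorm (gam t) <= G) ->
  (forall t, rnorm t < 4 * rho -> gam t != 0 -> hol f t) ->
  (forall t, rnorm t < 4 * rho -> gam t != 0 -> rnorm (f t) <= M) ->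
  gam 0 != 0 -> gam 1 != 0 -> rnorm (f 1 - f 0) <= 2 * M / rho.
Proof.
move=> rho1 hgam bgam hf bf g0 g1.
have rho0 : 0 < rho by lra.
have M0 : 0 <= M by apply: le_trans (bf 0 _ g0); rewrite ?rnorm_ge0 ?rnorm0 //; lra.
have hf0 : hol f 0 by apply: hf => //; rewrite rnorm0; lra.
have bf0 : rnorm (f 0) <= M by apply: bf => //; rewrite rnorm0; lra.
have [c Hc] := hf0; have [d d0 Hd] := Hc 1 ltr01.
(* The extra factor [t] turns the undefined point 0 of the difference quotient into one more zero of
   the auxiliary function. *)
pose B (t : C) := (f t - f 0) / t; pose gam' (t : C) := t * gam t.
have in4 (t : C) : rnorm t < 3 * rho -> rnorm (1 + t) < 4 * rho.
  by move=> tr; rewrite (le_lt_trans (rnormD _ _)) // rnorm1; lra.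
have gam'0 (t : C) : gam' t != 0 -> t != 0 /\ gam t != 0.
  by rewrite mulf_eq0 negb_or => /andP.
have -> : f 1 - f 0 = B (1 + 0) by rewrite /B addr0 divr1.
(* Since [1 <= rho], the disc of radius [3 * rho] about 1 lies in the domain, and points at distance
   [2 * rho] from 1 have modulus at least [rho]. The crude bound for [B] combines the derivative of
   [f] within distance [d] of 0 with division by at least [d] elsewhere. *)
apply: (@max_modulus_off_zeros (fun t => B (1 + t)) (fun t => gam' (1 + t)) (2 * rho) (3 * rho)
  _ (rnorm c + 1 + 2 * M / d) (4 * rho * G)).
- lra.
- by rewrite divr_ge0 ?mulr_ge0 // ltW.
- move=> t /in4 /hgam/holP dg; apply: (@hol_shift gam').
  by apply/holP; apply: differentiableM.
- move=> t /in4 tr; rewrite rnormM ler_pM ?rnorm_ge0 ?bgam // ltW //.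
- move=> t /in4 tr /gam'0[t0 gt]; have /holP df := hf _ tr gt.
  apply: (@hol_shift B); apply/holP; apply: differentiableM; last exact: differentiableV.
  exact: differentiableB.
- move=> t /in4 tr /gam'0[t0 gt]; set w := 1 + t in tr t0 gt *.
  have w0 : 0 < rnorm w by rewrite rnorm_gt0.
  rewrite rnormM rnormV ler_pdivrMr // mulrDl.
  have [wd|dw] := ltP (rnorm w) d.
    have := Hd w wd; rewrite add0r => Hw.
    rewrite -[f w - f 0](subrK (c * w)) (le_trans (rnormD _ _)) // rnormM.
    have : 0 <= 2 * M / d * rnorm w by rewrite mulr_ge0 ?divr_ge0 ?mulr_ge0 // ltW.
    lra.
  have : rnorm (f w - f 0) <= 2 * M.
    by rewrite (le_trans (rnormB _ _)) // mulrDl mul1r lerD // bf.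
  have : 2 * M <= 2 * M / d * rnorm w.
    by rewrite mulrAC ler_pdivlMr // ler_wpM2l // mulr_ge0.
  have : 0 <= (rnorm c + 1) * rnorm w by rewrite mulr_ge0 ?addr_ge0 ?rnorm_ge0.
  lra.
- move=> t tr /gam'0[t0 gt]; set w := 1 + t in t0 gt *.
  have w1 : rho <= rnorm w.
    have := rdist_ge t (- 1); rewrite opprK rnormN rnorm1 tr [t + 1]addrC; lra.
  have w4 : rnorm w < 4 * rho by apply: in4; rewrite tr; lra.
  rewrite rnormM rnormV ler_pM ?invr_ge0 ?rnorm_ge0 //.
    by rewrite (le_trans (rnormB _ _)) // mulrDl mul1r lerD // bf.
  by rewrite lef_pV2 ?posrE // rnorm_gt0.
- by rewrite /gam' addr0 mul1r.
Qed.
End Schwarz.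

(** * Lipschitz estimates along complex lines *)

Section RowVectors.
Variable R : realType.
Local Notation C := R[i].

Lemma rnorm_coord n (v : 'rV[C]_n) i : rnorm (v 0 i) <= rnorm v.
Proof.
rewrite -lecR -!rnormE -[`|v|]/(mx_norm v) mx_normE -[leLHS]nngE num_le.
exact: (le_bigmax _ _ (0, i)).
Qed.

Lemma rnorm_rV_le n (v : 'rV[C]_n) (M : R) : 0 <= M ->
  (forall i, rnorm (v 0 i) <= M) -> rnorm v <= M.
Proof.
move=> M0 H; have [v0|] := eqVneq (mx_norm v) 0.
  by rewrite (mx_norm_eq0 v0) rnorm0.
move=> /mx_norm_neq0[[i j] /= vij]; rewrite /rnorm [`|v|]vij ord1.
exact: H.
Qed.

Lemma line_differentiable (V : normedModType C) (a v : V) (t : C) :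
  differentiable (fun t : C => a + t *: v) t.
Proof. exact: (@differentiableD _ _ _ (cst a) (fun t : C => t *: v)). Qed.

Lemma hol_line_coord (V : normedModType C) m (f : V -> 'rV[C]_m) (a v : V) (t : C) j :
  differentiable f (a + t *: v) -> hol (fun t => f (a + t *: v) 0 j) t.
Proof.
move=> df; apply/holP.
apply: (@differentiable_comp _ _ _ _ (fun t : C => f (a + t *: v)) (fun N : 'rV[C]_m => N 0 j)).
  by apply: (@differentiable_comp _ _ _ _ (fun t : C => a + t *: v) f) => //;
    exact: line_differentiable.
exact: differentiable_coord.
Qed.

(** [schwarz_off_zeros] for each coordinate of [f] on the complex line through [a] (at [t = 0]) and
    [b] (at [t = 1]). Everything is asked along this line only, because [f] will be an inverse map
    that is holomorphic merely along a slice. *)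
Lemma line_schwarz (V : normedModType C) m (f : V -> 'rV[C]_m) (gam : V -> C) (a b : V)
    (r M G : R) : 0 < r -> rnorm (b - a) <= r / 4 ->
  (forall t : C, rnorm t * rnorm (b - a) < r ->
     [/\ hol (fun t => gam (a + t *: (b - a))) t, rnorm (gam (a + t *: (b - a))) <= G
       & gam (a + t *: (b - a)) != 0 ->
         (forall j, hol (fun t => f (a + t *: (b - a)) 0 j) t) /\
         rnorm (f (a + t *: (b - a))) <= M]) ->
  gam a != 0 -> gam b != 0 -> rnorm (f b - f a) <= 8 * M / r * rnorm (b - a).
Proof.
move=> r0 ba H ga gb.
have [->|nab] := eqVneq b a; first by rewrite !subrr !rnorm0 mulr0.
have d0 : 0 < rnorm (b - a) by rewrite rnorm_gt0 subr_eq0.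
set d := rnorm (b - a) in ba H d0 *.
have E0 : a + 0 *: (b - a) = a by rewrite scale0r addr0.
have E1 : a + 1 *: (b - a) = b by rewrite scale1r addrC subrK.
have M0 : 0 <= M.
  have [|_ _] := H 0; first by rewrite rnorm0 mul0r.
  by rewrite E0 => /(_ ga)[_ /(le_trans (rnorm_ge0 _))].
(* With this value [rnorm t < 4 * rho] says exactly [rnorm t * d < r], and [rnorm (b - a) <= r / 4]
   says [1 <= rho]. *)
pose rho := r / (4 * d).
have rhod : 4 * rho * d = r by rewrite /rho; field; rewrite gt_eqF.
have td (t : C) : rnorm t < 4 * rho -> rnorm t * d < r.
  by move=> tr; rewrite -rhod ltr_pM2r.
have -> : 8 * M / r * d = 2 * M / rho by rewrite /rho; field; rewrite !gt_eqF.
have rho1 : 1 <= rho by rewrite /rho ler_pdivlMr ?mulr_gt0 // mul1r; lra.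
clearbody rho; have rho0 : 0 < rho by lra.
apply: rnorm_rV_le; first by apply: divr_ge0; [exact: mulr_ge0|exact: ltW].
move=> j; rewrite !mxE.
have := @schwarz_off_zeros _ (fun t => f (a + t *: (b - a)) 0 j)
  (fun t => gam (a + t *: (b - a))) rho M G rho1.
rewrite E0 E1; apply=> //.
- by move=> t /td /H[].
- by move=> t /td /H[].
- by move=> t /td /H[_ _] G0 /G0[].
- by move=> t /td /H[_ _] G0 /G0[_]; apply: le_trans; exact: rnorm_coord.
Qed.

(** Cauchy's estimate in Lipschitz form: [line_schwarz] with constant [gam], along lines that stay
    within [r / 2] of [a] and thus within [r] of [z0]. *)
Lemma holomorphic_lipschitz n m (f : 'rV[C]_n -> 'rV[C]_m) (z0 a b : 'rV[C]_n) (r M : R) :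
  0 < r -> (forall z, rnorm (z - z0) < r -> differentiable f z) ->
  (forall z, rnorm (z - z0) < r -> rnorm (f z) <= M) ->
  rnorm (a - z0) < r / 16 -> rnorm (b - z0) < r / 16 ->
  rnorm (f b - f a) <= 16 * M / r * rnorm (b - a).
Proof.
move=> r0 df bf az bz.
have ba : rnorm (b - a) <= (r / 2) / 4.
  by rewrite (le_trans (rdist_trans z0 _ _)) // (rdistC z0); lra.
have -> : 16 * M / r = 8 * M / (r / 2) by field; rewrite gt_eqF.
apply: (@line_schwarz _ _ f (fun=> 1) _ _ _ _ 1) => //; rewrite ?oner_eq0 //; first by lra.
move=> t tr; set z := a + _.
have zr : rnorm (z - z0) < r.
  rewrite /z addrAC (le_lt_trans (rnormD _ _)) // rnormZ; lra.
split; rewrite ?rnorm1 //; first by apply/holP; exact: (differentiable_cst (1 : C)).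
move=> _; split; last exact: bf.
by move=> j; apply: hol_line_coord; exact: df.
Qed.

End RowVectors.

(** * Absence of local maxima *)

Section LocalMax.
Variable R : realType.
Local Notation C := R[i].

(** Summation over the fourth roots of unity cancels the cross terms; this is the second-order gain
    of |z|^2 along a complex line. *)
Lemma parallelogram4 (a b : C) :
  rnorm (a + b) ^+ 2 + rnorm (a - b) ^+ 2 +
  (rnorm (a + 'i%C * b) ^+ 2 + rnorm (a - 'i%C * b) ^+ 2) =
  4 * rnorm a ^+ 2 + 4 * rnorm b ^+ 2.
Proof. by case: a b => [a1 a2] [b1 b2]; rewrite !rnorm_sqr /=; ring. Qed.

(** For fixed [h] this splits |x|^2 into the real part of a linear function of [x], open to the
    maximum principle, a constant, and a remainder quadratic in [x - h]. *)
Lemma rnorm_sqr_expand (h x : C) : rnorm x ^+ 2 =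
  2 * complex.Re (h^*%C * x) - rnorm h ^+ 2 + rnorm (x - h) ^+ 2.
Proof. by case: h x => [a1 a2] [b1 b2]; rewrite !rnorm_sqr /=; ring. Qed.

(** The product of the four factors is a^4 - b^4, so the logarithms deviate from [4 * ln |a|] only
    to fourth order in [b / a]; the bound 1/2 allows ln (1 - x) >= -2x. *)
Lemma ln_prod4_ge (a b : C) : a != 0 -> rnorm (b / a) ^+ 4 <= 2^-1 ->
  4 * ln (rnorm a) - 2 * rnorm (b / a) ^+ 4 <=
  ln (rnorm (a + b)) + ln (rnorm (a - b)) +
  (ln (rnorm (a + 'i%C * b)) + ln (rnorm (a - 'i%C * b))).
Proof.
move=> a0 ba; set x := rnorm (b / a) ^+ 4 in ba *.
have E : (a + b) * (a - b) * ((a + 'i%C * b) * (a - 'i%C * b)) = a ^+ 4 * (1 - (b / a) ^+ 4).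
  have i2 : 'i%C * 'i%C = -1 :> C by rewrite -sqr_i expr2.
  have -> : (a + 'i%C * b) * (a - 'i%C * b) = a ^+ 2 - ('i%C * 'i%C) * b ^+ 2 by ring.
  by rewrite i2; field.
have x1 : 1 - x <= rnorm (1 - (b / a) ^+ 4).
  by rewrite /x -rnormX -{1}(rnorm1 R) rdist_ge.
have x0 : 0 <= x by rewrite exprn_ge0 ?rnorm_ge0.
have p0 : 0 < rnorm ((a + b) * (a - b) * ((a + 'i%C * b) * (a - 'i%C * b))).
  by rewrite E rnormM rnormX mulr_gt0 // ?exprn_gt0 ?rnorm_gt0 //; rewrite -rnorm_gt0; lra.
have := p0; rewrite rnorm_gt0 !mulf_eq0 !negb_or => /andP[/andP[n1 n2] /andP[n3 n4]].
rewrite -!lnM ?posrE ?rnorm_gt0 ?mulf_neq0 // ?mulr_gt0 ?rnorm_gt0 //.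
rewrite -!rnormM E rnormM rnormX lnM ?posrE ?exprn_gt0 ?rnorm_gt0 //; last first.
  by rewrite -rnorm_gt0; lra.
rewrite lnXn ?rnorm_gt0 // -[ln (rnorm a) *+ 4]mulr_natl lerD2l.
have h1 : 0 < 1 - x by lra.
apply: (@le_trans _ _ (ln (1 - x))); last by rewrite ler_ln ?posrE //; lra.
have h2 : 0 < (1 - x)^-1 by rewrite invr_gt0.
have : ln (1 - x)^-1 <= (1 - x)^-1 - 1.
  have := expR_ge1Dx (ln (1 - x)^-1); rewrite lnK ?posrE //; lra.
rewrite lnV ?posrE // => H.
have : (1 - x)^-1 <= 1 + 2 * x by rewrite -div1r ler_pdivrMr //; nra.
lra.
Qed.
End LocalMax.

Section NoMax.
Variable R : realType.
Local Notation C := R[i].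

Lemma common_kernel n m (L : 'I_m -> {linear 'rV[C]_n -> C}) : (m < n)%N ->
  exists2 xi : 'rV[C]_n, xi != 0 & forall j, L j xi = 0.
Proof.
move=> mn; pose M : 'M[C]_(n, m) := \matrix_(k, j) L j (delta_mx 0 k).
have : kermx M != 0.
  by rewrite -mxrank_eq0 mxrank_ker -lt0n subn_gt0 (leq_ltn_trans (rank_leq_col _)).
move=> /rowV0Pn[xi /sub_kermxP xiM xi0]; exists xi => // j.
have /matrixP/(_ 0 j) := xiM; rewrite !mxE => H; rewrite -[RHS]H.
rewrite {1}[xi]row_sum_delta linear_sum; apply: eq_bigr => k _.
by rewrite linearZ !mxE.
Qed.

Lemma hol_sum (I : finType) (F : I -> C -> C) t : (forall j, hol (F j) t) ->
  hol (fun t => \sum_j F j t) t.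
Proof.
move=> H; apply/holP; rewrite -[X in differentiable X _]fct_sumE.
elim/big_ind: _ => [|f g|j _]; [exact: (differentiable_cst (0 : C))|exact: differentiableD|].
exact/holP.
Qed.

Lemma Re_sum (I : finType) (F : I -> C) : complex.Re (\sum_j F j) = \sum_j complex.Re (F j).
Proof. by elim/big_ind2: _ => // ? ? ? ? <- <-; rewrite ReD. Qed.

(** Sums of squares of coordinates are used here in place of [rnorm], which is the maximum norm on
    row vectors. *)
Definition lyapunov n m (h : 'I_m -> 'rV[C]_n -> C) (i : 'I_n) (K delta : R) (z : 'rV[C]_n) : R :=
  \sum_k rnorm (z 0 k) ^+ 2 - K * (\sum_j rnorm (h j z) ^+ 2) + delta * ln (rnorm (z 0 i)).

(* Along a complex line in the kernel of all the differentials dh_j, averaging the three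
   terms over the four points z0 + i^k t xi shows that the value at z0 is exceeded. *)
Lemma lyapunov_no_max n m (h : 'I_m -> 'rV[C]_n -> C) (i : 'I_n) (K delta rho : R)
    (z0 : 'rV[C]_n) : (m < n)%N -> 0 < rho -> 0 <= K -> 0 <= delta -> z0 0 i != 0 ->
  (forall j z, rnorm (z - z0) < rho -> differentiable (h j) z) ->
  ~ (forall z, rnorm (z - z0) < rho ->
       lyapunov h i K delta z <= lyapunov h i K delta z0).
Proof.
move=> mn rho0 K0 de0 zi dh umax.
have z0r : rnorm (z0 - z0) < rho by rewrite subrr rnorm0.
have [xi xi0 hxi] := @common_kernel n m (fun j => 'd (h j) z0) mn.
pose P (z : 'rV[C]_n) := \sum_k rnorm (z 0 k) ^+ 2.
have Pxi : 0 < P xi.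
  have /rV0Pn[k xik] := xi0.
  rewrite /P (bigD1 k) //= ltr_wpDr ?sumr_ge0 ?exprn_gt0 ?rnorm_gt0 // => *.
  by rewrite exprn_ge0 ?rnorm_ge0.
have nxi : 0 < rnorm xi by rewrite rnorm_gt0.
(* Budget over the four points: the first term gains [4 * r ^+ 2 * P xi]. The remainder of the
   [h j], the margin of the maximum principle and the logarithm lose at most [r ^+ 2 * P xi] each.
   This [e2] settles the first loss. *)
pose e2 := P xi / (4 * K * m%:R + 1).
have km0 : 0 <= K * m%:R by rewrite mulr_ge0.
have e20 : 0 < e2 by rewrite divr_gt0 //; lra.
pose e := Num.sqrt e2 / rnorm xi.
have e0 : 0 < e by rewrite divr_gt0 // sqrtr_gt0.
have e2b : 4 * K * m%:R * (e * rnorm xi) ^+ 2 <= P xi.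
  rewrite /e divfK ?gt_eqF // sqr_sqrtr ?(ltW e20) // /e2 mulrA ler_pdivrMr; last by lra.
  by rewrite mulrC ler_wpM2l ?(ltW Pxi) //; lra.
have [d d0 Hd] : exists2 d : R, 0 < d & forall j (v : 'rV[C]_n), rnorm v < d ->
    rnorm (h j (z0 + v) - h j z0 - 'd (h j) z0 v) <= e * rnorm v.
  have : \forall v \near (0 : 'rV[C]_n), forall j,
      rnorm (h j (z0 + v) - h j z0 - 'd (h j) z0 v) <= e * rnorm v.
    have := @filter_forall _ 'I_m (fun j v => rnorm (h j (z0 + v) - h j z0 - 'd (h j) z0 v)
      <= e * rnorm v) (nbhs (0 : 'rV[C]_n)) _.
    move=> /(_ (nbhs_filter _)); apply => j.
    by have /near0_rnormP := differentiable_eps (dh j z0 z0r) e0.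
  by move=> /near0_rnormP[d d0 H]; exists d => // j v /H.
pose b := xi 0 i / z0 0 i.
set b4 := rnorm b ^+ 4.
have b40 : 0 <= b4 by rewrite exprn_ge0 ?rnorm_ge0.
(* The first two bounds keep the four points in the ball and within reach of the differentials; the
   others make the fourth-order error of the logarithm at most [r ^+ 2 * P xi]. *)
have [r [r0 [rrho rd r1 rb rP]]] : exists r : R, 0 < r /\
    [/\ r * rnorm xi < rho, r * rnorm xi < d, r <= 1, r * b4 <= 2^-1 &
     2 * (delta * b4) * r <= P xi].
  have b41 : 0 < 2 * (b4 + 1) by lra.
  have db : 0 < 2 * (delta * b4 + 1) by have := mulr_ge0 de0 b40; lra.
  have x2 : 0 < 2 * rnorm xi by lra.
  pose r1 := rho / (2 * rnorm xi); pose r2 := d / (2 * rnorm xi).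
  pose r3 := (2 * (b4 + 1))^-1; pose r4 := P xi / (2 * (delta * b4 + 1)).
  pose r := Num.min r1 (Num.min r2 (Num.min r3 (Num.min r4 1))).
  have : [/\ r <= r1, r <= r2, r <= r3, r <= r4 & r <= 1].
    by rewrite /r !ge_min !lexx !orbT.
  have : 0 < r by rewrite /r !lt_min !divr_gt0 ?invr_gt0 ?b41 ?ltr01.
  clearbody r => r0 [h1 h2 h3 h4 h5].
  move: h1 h2 h4; rewrite /r1 /r2 /r4 !ler_pdivlMr // => h1 h2 h4.
  have h3' : r * (2 * (b4 + 1)) <= 1 by rewrite -ler_pdivlMr // div1r.
  have rx := mulr_gt0 r0 nxi; exists r; split=> //; split=> //; lra.
pose w (om : C) := z0 + om *: xi.
have wr (om : C) : rnorm om <= r -> rnorm (w om - z0) < rho.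
  by move=> omr; rewrite /w addrAC subrr add0r rnormZ (le_lt_trans _ rrho) // ler_wpM2r ?rnorm_ge0.
pose S4 (F : 'rV[C]_n -> C) (t : C) :=
  F (w t) + F (w (- t)) + (F (w ('i%C * t)) + F (w (- ('i%C * t)))).
(* The real part of this holomorphic function is the linear part of -K |H|^2 summed over the four
   points. The maximum principle gives one [t] of modulus [r] that serves all four points and all
   [j] at once. *)
pose q (t : C) := (- (2 * K))%:C%C * \sum_j (h j z0)^*%C * S4 (h j) t.
have nit (t : C) : rnorm ('i%C * t) = rnorm t by rewrite rnormM rnormi mul1r.
have hw (om t : C) j : rnorm om = 1 -> rnorm t <= r -> hol (fun t => h j (w (om * t))) t.
  move=> om1 tr; apply/holP.
  apply: (@differentiable_comp _ _ _ _ (fun t : C => w (om * t)) (h j)); last first.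
    by apply: dh; apply: wr; rewrite rnormM om1 mul1r.
  rewrite /w; apply: (@differentiable_comp _ _ _ _ (fun t : C => om * t)
    (fun t : C => z0 + t *: xi)).
    exact: (@differentiableZ _ _ _ id om).
  exact: line_differentiable.
have hq t : rnorm t <= r -> hol q t.
  move=> tr; apply/holP; apply: differentiableM; first exact: differentiable_cst.
  apply/holP/hol_sum => j; apply/holP; apply: differentiableM; first exact: differentiable_cst.
  have -> : S4 (h j) = fun t => h j (w (1 * t)) + h j (w ((-1) * t)) +
      (h j (w ('i%C * t)) + h j (w ((- 'i%C) * t))).
    by apply/funext => x; rewrite /S4 mul1r mulN1r mulNr.
  do 2 apply: differentiableD; apply/holP/hw => //; rewrite ?rnormN ?rnorm1 ?rnormi //.
have m0 : 0 < r ^+ 2 * P xi by rewrite mulr_gt0 ?exprn_gt0.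
have [||t tr Ht] := @max_principle_Re _ q r r0 _ _ _ m0.
  by move=> t /andP[_ /hq].
  have h0 : hol q 0 by apply: hq; rewrite rnorm0 ltW.
  by move=> a a0; have [a1 a10 H] := hol_cont h0 a0; exists a1 => // t /H; rewrite add0r.
pose u4 (F : 'rV[C]_n -> R) := F (w t) + F (w (- t)) + (F (w ('i%C * t)) + F (w (- ('i%C * t)))).
have U : u4 (lyapunov h i K delta) <= 4 * lyapunov h i K delta z0.
  have Ht1 := umax _ (wr t _); have Ht2 := umax _ (wr (- t) _).
  have Ht3 := umax _ (wr ('i%C * t) _); have Ht4 := umax _ (wr (- ('i%C * t)) _).
  rewrite !(rnormN, nit) tr in Ht1 Ht2 Ht3 Ht4.
  move: (Ht1 (lexx _)) (Ht2 (lexx _)) (Ht3 (lexx _)) (Ht4 (lexx _)).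
  by rewrite /u4; clear; move=> *; lra.
have wE s k : w s 0 k = z0 0 k + s * xi 0 k by rewrite !mxE.
have PU : u4 P = 4 * P z0 + 4 * r ^+ 2 * P xi.
  rewrite /u4 /P !mulr_sumr -!big_split; apply: eq_bigr => k _ /=.
  rewrite !wE !mulNr -mulrA parallelogram4 rnormM tr; ring.
pose Q (z : 'rV[C]_n) := \sum_j rnorm (h j z) ^+ 2.
have QU : K * u4 Q <= 4 * (K * Q z0) + r ^+ 2 * P xi + r ^+ 2 * P xi.
  have req s : complex.Re (q s) = - (2 * K) * \sum_j complex.Re ((h j z0)^*%C * S4 (h j) s).
    by rewrite ReMc Re_sum.
  have q0E : complex.Re (q 0) = - (8 * (K * Q z0)).
    rewrite req (_ : \sum_j _ = 4 * Q z0); first by ring.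
    rewrite /Q mulr_sumr; apply: eq_bigr => j _.
    rewrite /S4 mulr0 oppr0 /w scale0r addr0 rnorm_sqr.
    by case: (h j z0) => a1 a2 /=; ring.
  have T j : u4 (fun z => rnorm (h j z) ^+ 2) <=
      2 * complex.Re ((h j z0)^*%C * S4 (h j) t) - 4 * rnorm (h j z0) ^+ 2 +
      4 * (e * (r * rnorm xi)) ^+ 2.
    have err s : rnorm s = r -> rnorm (h j (w s) - h j z0) ^+ 2 <= (e * (r * rnorm xi)) ^+ 2.
      move=> sr; have nsr : rnorm (s *: xi) = r * rnorm xi by rewrite rnormZ sr.
      have := Hd j (s *: xi); rewrite nsr => /(_ rd).
      have -> : 'd (h j) z0 (s *: xi) = 0 by rewrite linearZ hxi; exact: mulr0.
      rewrite subr0 -/(w s) => H.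
      by rewrite lerXn2r ?nnegrE ?rnorm_ge0 // (le_trans _ H) ?rnorm_ge0.
    have := err t; have := err (- t); have := err ('i%C * t); have := err (- ('i%C * t)).
    rewrite !(rnormN, nit) => /(_ tr) E4 /(_ tr) E3 /(_ tr) E2 /(_ tr) E1.
    rewrite /u4 /S4 !mulrDr !ReD.
    rewrite (rnorm_sqr_expand (h j z0) (h j (w t))).
    rewrite (rnorm_sqr_expand (h j z0) (h j (w (- t)))).
    rewrite (rnorm_sqr_expand (h j z0) (h j (w ('i%C * t)))).
    rewrite (rnorm_sqr_expand (h j z0) (h j (w (- ('i%C * t))))).
    by move: E1 E2 E3 E4; clear; move=> *; lra.
  have T2 : u4 Q <= \sum_j (2 * complex.Re ((h j z0)^*%C * S4 (h j) t)
      - 4 * rnorm (h j z0) ^+ 2 + 4 * (e * (r * rnorm xi)) ^+ 2).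
    by rewrite /u4 /Q -!big_split; apply: ler_sum => j _; exact: T.
  have T3 : K * u4 Q <= - complex.Re (q t) - 4 * (K * Q z0)
       + r ^+ 2 * (4 * K * m%:R * (e * rnorm xi) ^+ 2).
    rewrite (le_trans (ler_wpM2l K0 T2)) // req !big_split /= sumr_const card_ord.
    by rewrite sumrN -!mulr_sumr -/(Q z0) -mulr_natl le_eqVlt; apply/orP; left; apply/eqP; ring.
  have := ler_wpM2l (exprn_ge0 2 (ltW r0)) e2b.
  by rewrite q0E in Ht; move: Ht T3; clear; move=> *; lra.
pose N (z : 'rV[C]_n) := ln (rnorm (z 0 i)).
have NU : 4 * (delta * N z0) - r ^+ 2 * P xi <= delta * u4 N.
  have xb : rnorm (t * xi 0 i / z0 0 i) ^+ 4 = r ^+ 4 * b4.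
    by rewrite -mulrA rnormM tr exprMn.
  have r2r : r ^+ 2 <= r by rewrite expr2 ler_piMr // ltW.
  have r44 : r ^+ 4 = r ^+ 2 * r ^+ 2 by rewrite -exprD.
  have r4r : r ^+ 4 <= r.
    rewrite r44; apply: (le_trans _ r2r).
    by rewrite -[leRHS]mulr1 ler_wpM2l ?sqr_ge0 // (le_trans r2r).
  have H : 4 * N z0 - 2 * (r ^+ 4 * b4) <= u4 N.
    rewrite -xb /u4 /N !wE !mulNr -['i%C * t * _]mulrA; apply: ln_prod4_ge => //.
    by rewrite xb (le_trans _ rb) // ler_wpM2r.
  have := ler_wpM2l de0 H.
  have := ler_wpM2l (exprn_ge0 2 (ltW r0)) rP.
  have : 2 * (delta * b4) * (r ^+ 2 * r ^+ 2) <= 2 * (delta * b4) * (r ^+ 2 * r).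
    apply: ler_wpM2l; first by apply: mulr_ge0 => //; exact: mulr_ge0.
    by apply: ler_wpM2l => //; exact: sqr_ge0.
  by rewrite r44; clear; move=> *; lra.
have E z : lyapunov h i K delta z = P z - K * Q z + delta * N z by [].
have uE : u4 (lyapunov h i K delta) = u4 P - K * u4 Q + delta * u4 N by rewrite /u4 !E; ring.
by move: U PU QU NU m0; rewrite uE E; clear; move=> *; lra.
Qed.
End NoMax.

(** * Compactness *)

Section Compactness.
Variable R : realType.
Local Notation C := R[i].

Lemma rdist_continuous (V : normedModType C) (a : V) : continuous (fun v => rnorm (v - a)).
Proof.
move=> v; apply/cvgrPdist_lt => e e0; apply/near_rnormP; exists e => // w wv.
apply: le_lt_trans wv; have := rdist_trans v w a; have := rdist_trans w v a.
rewrite (rdistC v w) ler_norml; lra.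
Qed.

Lemma cvg_rnorm (T : topologicalType) (V : normedModType C) (f : T -> V) (x : T) :
  (forall e : R, 0 < e -> \forall y \near x, rnorm (f y - f x) < e) -> {for x, continuous f}.
Proof.
move=> H; apply/cvgrPdist_lt => e e0.
have er : e = (complex.Re e)%:C%C by rewrite RRe_real // gtr0_real.
rewrite er ltcR in e0; apply: filterS (H _ e0) => y.
by rewrite distrC rnormE er ltcR.
Qed.

Lemma complex_continuous : continuous (fun p : R * R => (p.1 +i* p.2)%C : C).
Proof.
move=> p; apply: cvg_rnorm => e e0.
have c1 : {for p, continuous (fst : R * R -> R)} by exact: cvg_fst.
have c2 : {for p, continuous (snd : R * R -> R)} by exact: cvg_snd.
have e2 : 0 < e / 2 by lra.
move/cvgrPdist_lt : c1 => /(_ _ e2) c1; move/cvgrPdist_lt : c2 => /(_ _ e2) c2.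
near=> q; rewrite (le_lt_trans (rnorm_le_ReIm _)) //=.
rewrite [e]splitr ltrD //; rewrite distrC; near: q; [exact: c1|exact: c2].
Unshelve. all: by end_near. Qed.

(** The ball is closed in a product of squares, each of them the image of a product of two real
    segments. *)
Lemma compact_closed_ball n (z0 : 'rV[C]_n) (r : R) :
  compact [set z | rnorm (z - z0) <= r].
Proof.
pose I (x : R) := `[x - r, x + r]%classic.
pose D (c : C) : set C :=
  (fun p : R * R => (p.1 +i* p.2)%C) @` (I (complex.Re c) `*` I (complex.Im c)).
have cD c : compact (D c).
  apply: continuous_compact; last by apply: compact_setX; exact: segment_compact.
  exact/continuous_subspaceT/complex_continuous.
have cK : compact [set z : 'rV[C]_n | forall i, D (z0 0 i) (z 0 i)].
  exact: (@rV_compact _ n (fun i => D (z0 0 i))).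
apply: subclosed_compact cK _.
  suff : closed ((fun z : 'rV[C]_n => rnorm (z - z0)) @^-1` [set x | x <= r]) by [].
  apply: preimage_closed; last exact: closed_le.
  by move=> z _; exact: rdist_continuous.
move=> z zr i; exists (complex.Re (z 0 i), complex.Im (z 0 i)); last by case: (z 0 i).
have zi : rnorm (z 0 i - z0 0 i) <= r.
  by rewrite (le_trans _ zr) // (le_trans _ (rnorm_coord _ i)) // !mxE.
split; rewrite /I /= in_itv /=.
  have := le_trans (ler_Re_rnorm _) zi; rewrite ReD ReN ler_norml; lra.
have := le_trans (ler_Im_rnorm _) zi.
by case: (z 0 i) (z0 0 i) => [? ?] [? ?] /=; rewrite ler_norml; lra.
Qed.

End Compactness.

(** * A lower bound for the target dimension *)

Section Core.
Variable R : realType.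
Local Notation C := R[i].

Lemma rnorm_continuous (V : normedModType C) : continuous (@rnorm R V).
Proof.
move=> v; have := @rdist_continuous R V 0 v.
by rewrite (_ : (fun v => _) = @rnorm R V) //; apply/funext => x; rewrite subr0.
Qed.

Lemma cvg_rnorm_comp (T : topologicalType) (V : normedModType C) (f : T -> V) (x : T) :
  {for x, continuous f} -> {for x, continuous (fun y => rnorm (f y))}.
Proof. by move=> cf; apply: cvg_comp; [exact: cf|exact: rnorm_continuous]. Qed.

Lemma cvg_sum_sqr (T : topologicalType) (I : finType) (f : I -> T -> C) (x : T) :
  (forall j, {for x, continuous (f j)}) ->
  {for x, continuous (fun y => \sum_j rnorm (f j y) ^+ 2)}.
Proof.
move=> cf; rewrite /continuous_at; apply: cvg_big => [|j _].
  by move=> p; exact: add_continuous.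
by apply: cvgM; exact: cvg_rnorm_comp.
Qed.

Lemma cvg_combination (T : topologicalType) (P Q N : T -> R) (K d : R) (x : T) :
  {for x, continuous P} -> {for x, continuous Q} -> {for x, continuous N} ->
  {for x, continuous (fun y => P y - K * Q y + d * N y)}.
Proof.
move=> cP cQ cN; rewrite /continuous_at; apply: cvgD.
  by apply: cvgB => //; apply: cvgM => //; exact: cvg_cst.
by apply: cvgM => //; exact: cvg_cst.
Qed.

Lemma lyapunov_continuous n m (h : 'I_m -> 'rV[C]_n -> C) (i : 'I_n) (K delta : R)
    (z : 'rV[C]_n) : z 0 i != 0 -> (forall j, {for z, continuous (h j)}) ->
  {for z, continuous (lyapunov h i K delta)}.
Proof.
move=> zi ch; have cc k : {for z, continuous (fun y : 'rV[C]_n => y 0 k)}.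
  exact: coord_continuous.
apply: cvg_combination; [exact: cvg_sum_sqr|exact: cvg_sum_sqr|].
apply: (@continuous_comp _ _ _ (fun y : 'rV[C]_n => rnorm (y 0 i)) (@ln R)).
  exact: cvg_rnorm_comp.
by apply: continuous_ln; rewrite rnorm_gt0.
Qed.

Lemma lyapunov_bound n (z zs : 'rV[C]_n) (R0 : R) : rnorm (z - zs) <= R0 ->
  \sum_k rnorm (z 0 k) ^+ 2 <= n%:R * (rnorm zs + R0) ^+ 2.
Proof.
move=> zr; have zb : rnorm z <= rnorm zs + R0.
  by rewrite -[z](subrK zs) (le_trans (rnormD _ _)) // addrC lerD2l.
rewrite -[n in n%:R]card_ord mulr_natl -sumr_const; apply: ler_sum => k _.
by rewrite lerXn2r ?nnegrE ?rnorm_ge0 ?(le_trans (rnorm_coord _ _)) // (le_trans _ zb) ?rnorm_ge0.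
Qed.

(* The factor z_i in both hypotheses allows Phi to vanish on the hyperplane z_i = 0: what matters
   is Phi / z_i, and the term [delta * ln |z_i|] keeps the maximum away from that hyperplane. *)
Lemma zero_set_dim n m (Phi : 'rV[C]_n -> 'rV[C]_m) (i : 'I_n) (zs : 'rV[C]_n) (R0 c : R) :
  0 < R0 -> 0 < c -> (forall z, differentiable Phi z) ->
  (forall z, rnorm (z - zs) = R0 -> c * rnorm (z 0 i) <= rnorm (Phi z)) ->
  (forall eta : R, 0 < eta -> exists z : 'rV[C]_n,
     [/\ rnorm (z - zs) < R0, z 0 i != 0 & rnorm (Phi z) <= eta * rnorm (z 0 i)]) ->
  (n <= m)%N.
Proof.
move=> R00 c0 dPhi bd ref; rewrite leqNgt; apply/negP => mn.
pose h (j : 'I_m) (z : 'rV[C]_n) := Phi z 0 j / z 0 i.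
pose Pm := n%:R * (rnorm zs + R0) ^+ 2.
have Pm0 : 0 <= Pm by rewrite mulr_ge0 ?sqr_ge0.
(* [Pm] bounds the first term on the ball. On the sphere the second term is then at least [Pm + 2],
   so the function is at most [-2 + delta * ln B] there. *)
pose K := (Pm + 2) / c ^+ 2.
have K0 : 0 < K by rewrite divr_gt0 ?exprn_gt0 //; lra.
(* Makes [K * Q y] at most 1/2 at the reference point [y]. *)
pose eta2 := (2 * (K * m%:R + 1))^-1.
have Km0 : 0 <= K * m%:R by rewrite mulr_ge0 // ltW.
have eta20 : 0 < eta2 by rewrite invr_gt0; lra.
have eta0 : 0 < Num.sqrt eta2 by rewrite sqrtr_gt0.
have [y [yr yi Hy]] := ref _ eta0.
pose B := rnorm zs + R0 + 1.
have B1 : 1 <= B by rewrite /B; have := rnorm_ge0 zs; lra.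
have lB0 : 0 <= ln B by rewrite ln_ge0.
(* Chosen after [y], so that the logarithmic term is at least -1/4 at [y] and at most 1/4 on the
   ball, where [B] bounds |z_i|. Hence the value at [y] is at least -3/4. *)
pose delta := (4 * (ln B + `|ln (rnorm (y 0 i))| + 1))^-1.
have t0 : 0 < 4 * (ln B + `|ln (rnorm (y 0 i))| + 1).
  by have := normr_ge0 (ln (rnorm (y 0 i))); lra.
have de0 : 0 < delta by rewrite invr_gt0.
have de1 : delta * (ln B + `|ln (rnorm (y 0 i))| + 1) = 4^-1.
  by rewrite /delta invfM -mulrA mulVf ?mulr1 // gt_eqF //; lra.
have dlB : 0 <= delta * ln B by rewrite mulr_ge0 // ltW.
have dly : 0 <= delta * `|ln (rnorm (y 0 i))| by rewrite mulr_ge0 // ltW.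
(* Where |z_i| equals [eps], the logarithmic term is [-(Pm + 2)] and the function is at most -2. *)
pose eps := expR (- ((Pm + 2) / delta)).
have deps : delta * ln eps = - (Pm + 2) by rewrite /eps expRK mulrN mulrC divfK // gt_eqF.
have eps0 : 0 < eps by exact: expR_gt0.
pose u := lyapunov h i K delta.
pose Q (z : 'rV[C]_n) := \sum_j rnorm (h j z) ^+ 2.
pose P (z : 'rV[C]_n) := \sum_k rnorm (z 0 k) ^+ 2.
have Q0 z : 0 <= Q z by rewrite sumr_ge0 // => j _; rewrite exprn_ge0 ?rnorm_ge0.
have P0 z : 0 <= P z by rewrite sumr_ge0 // => j _; rewrite exprn_ge0 ?rnorm_ge0.
have uE z : u z = P z - K * Q z + delta * ln (rnorm (z 0 i)) by [].
have uy : - 3 / 4 <= u y.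
  have Qy : Q y <= m%:R * eta2.
    rewrite -[m in m%:R]card_ord mulr_natl -sumr_const; apply: ler_sum => j _.
    rewrite -(sqr_sqrtr (ltW eta20)) lerXn2r ?nnegrE ?rnorm_ge0 ?(ltW eta0) //.
    rewrite rnormM rnormV ler_pdivrMr ?rnorm_gt0 //.
    by rewrite (le_trans _ Hy) // rnorm_coord.
  have KQ : K * Q y <= 2^-1.
    apply: (le_trans (ler_wpM2l (ltW K0) Qy)); rewrite mulrA /eta2.
    by rewrite ler_pdivrMr; lra.
  have := lerNnormlW (lexx `|ln (rnorm (y 0 i))|).
  move=> /(ler_wpM2l (ltW de0)).
  rewrite uE; have := P0 y; lra.
(* On this compact set a maximum exists. Both parts of its boundary carry values below -3/4, so the
   maximum is interior, contrary to [lyapunov_no_max]. *)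
pose Ks : set 'rV[C]_n := [set z | rnorm (z - zs) <= R0] `&` [set z | eps <= rnorm (z 0 i)].
have cK : compact Ks.
  apply: compact_closedI; first exact: compact_closed_ball.
  suff : closed ((fun z : 'rV[C]_n => rnorm (z 0 i)) @^-1` [set x | eps <= x]) by [].
  apply: preimage_closed; last exact: closed_ge.
  by move=> z _; apply: cvg_rnorm_comp; exact: coord_continuous.
have Ki (z : 'rV[C]_n) : eps <= rnorm (z 0 i) -> z 0 i != 0.
  by move=> ez; rewrite -rnorm_gt0 (lt_le_trans eps0).
have dh j (z : 'rV[C]_n) : z 0 i != 0 -> differentiable (h j) z.
  move=> zi; apply: differentiableM.
    apply: (@differentiable_comp _ _ _ _ Phi (fun N : 'rV[C]_m => N 0 j)) => //.
    exact: differentiable_coord.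
  by apply: differentiableV => //; exact: differentiable_coord.
have Ky : Ks y.
  split => /=; first exact: ltW.
  rewrite -ler_ln ?posrE ?rnorm_gt0 // -(ler_pM2l de0) deps.
  have := lerNnormlW (lexx `|ln (rnorm (y 0 i))|).
  move=> /(ler_wpM2l (ltW de0)); lra.
have [||z0 z0K z0max] := @compact_EVT_max _ _ u Ks _ cK.
- by exists y.
- apply: continuous_in_subspaceT => z; rewrite inE => -[_ /Ki zi].
  apply: lyapunov_continuous => // j.
  by apply: differentiable_continuous; exact: dh.
have uz0 : - 3 / 4 <= u z0 by rewrite (le_trans uy) // z0max // inE.
rewrite inE in z0K; case: z0K => /= z0r z0e.
have z0i := Ki _ z0e.
have Pz0 : P z0 <= Pm by exact: lyapunov_bound.
have z0r' : rnorm (z0 - zs) < R0.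
  rewrite lt_neqAle z0r andbT; apply/eqP => z0R.
  have := bd _ z0R.
  have cQ : c ^+ 2 <= Q z0.
    rewrite -(sqr_sqrtr (Q0 z0)) lerXn2r ?nnegrE ?sqrtr_ge0 ?(ltW c0) //.
    have z0p : 0 < rnorm (z0 0 i) by rewrite rnorm_gt0.
    rewrite -(ler_pM2r z0p) (le_trans (bd _ z0R)) //.
    apply: rnorm_rV_le => [|j]; first by rewrite mulr_ge0 ?sqrtr_ge0 // ltW.
    rewrite -ler_pdivrMr // -rnormV -rnormM -[leLHS]ger0_norm ?rnorm_ge0 //.
    rewrite -sqrtr_sqr ler_wsqrtr // /Q (bigD1 j) //= lerDl sumr_ge0 // => *.
    by rewrite exprn_ge0 ?rnorm_ge0.
  have : ln (rnorm (z0 0 i)) <= ln B.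
    rewrite ler_ln ?posrE ?rnorm_gt0 //; last by lra.
    have := rnorm_coord z0 i; have := rnormD (z0 - zs) zs; rewrite subrK /B; lra.
  move=> /(ler_wpM2l (ltW de0)).
  have := ler_wpM2l (ltW K0) cQ; rewrite {1}/K divfK ?gt_eqF ?exprn_gt0 //.
  move: uz0; rewrite uE; lra.
have z0e' : eps < rnorm (z0 0 i).
  rewrite lt_neqAle z0e andbT; apply/eqP => z0E.
  have := mulr_ge0 (ltW K0) (Q0 z0).
  move: uz0; rewrite uE -z0E deps; lra.
have [rho rho0 Hrho] : exists2 rho : R, 0 < rho & forall z, rnorm (z - z0) < rho ->
   rnorm (z - zs) <= R0 /\ eps <= rnorm (z 0 i).
  exists (Num.min (R0 - rnorm (z0 - zs)) (rnorm (z0 0 i) - eps)).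
    by rewrite lt_min !subr_gt0 z0r'.
  move=> z; rewrite lt_min => /andP[a1 a2]; split.
    by rewrite (le_trans (rdist_trans z0 _ _)) // -lerBrDr ltW.
  have := rdist_ge (z0 0 i) (z0 0 i - z 0 i); rewrite subKr.
  have := rnorm_coord (z - z0) i; rewrite !mxE rdistC.
  by move: a2; clear; move=> *; lra.
apply: (@lyapunov_no_max _ n m h i K delta rho z0 mn rho0 (ltW K0) (ltW de0) z0i).
  by move=> j z /Hrho[_ /Ki zi]; exact: dh.
by move=> z /Hrho[b1 b2]; apply: z0max; rewrite inE.
Qed.

End Core.

(** * Double points *)

Section DoublePoints.
Variable R : realType.
Local Notation C := R[i].

Lemma rnorm_lsubmx n m (z : 'rV[C]_(n + m)) : rnorm (lsubmx z) <= rnorm z.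
Proof. by apply: rnorm_rV_le => [|k]; rewrite ?rnorm_ge0 // !mxE rnorm_coord. Qed.

Lemma rnorm_rsubmx n m (z : 'rV[C]_(n + m)) : rnorm (rsubmx z) <= rnorm z.
Proof. by apply: rnorm_rV_le => [|k]; rewrite ?rnorm_ge0 // !mxE rnorm_coord. Qed.

Lemma rnorm_row0 n m (v : 'rV[C]_m) : rnorm (row_mx (0 : 'rV[C]_n) v) <= rnorm v.
Proof.
apply: rnorm_rV_le => [|k]; rewrite ?rnorm_ge0 // mxE; case: fintype.split => j.
  by rewrite mxE rnorm0 rnorm_ge0.
exact: rnorm_coord.
Qed.

Lemma compact_sphere n (z0 : 'rV[C]_n) (r : R) : compact [set z | rnorm (z - z0) = r].
Proof.
have cB := @compact_closed_ball R n z0 r.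
apply: subclosed_compact cB _; last by move=> z /= ->.
suff : closed ((fun z : 'rV[C]_n => rnorm (z - z0)) @^-1` [set x | x = r]) by [].
by apply: preimage_closed; [move=> z _; exact: rdist_continuous|exact: closed_eq].
Qed.

(** Since [G] is nonnegative, a bound persists when its constant grows; so the local constants are
    replaced by large integers, and compactness selects one integer for all points. *)
Lemma compact_uniform_bound (V : normedModType C) (K : set V) (F G : V -> R) : compact K ->
  (forall z, 0 <= G z) ->
  (forall z, K z -> exists c d : R, 0 < d /\ forall z', rnorm (z' - z) < d -> F z' <= c * G z') ->
  exists2 c : R, 0 < c & forall z, K z -> F z <= c * G z.
Proof.
move=> /compact_near_coveringP cK G0 H.
have [|N _ HN] := cK nat \oo (fun N z => F z <= N%:R * G z) _.
  move=> z /H[c [d [d0 Hd]]]; near=> z' N => /=.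
  rewrite (le_trans (Hd z' _)) ?ler_wpM2r //.
    by near: z'; apply/near_rnormP; exists d.
  rewrite (le_trans (ler_norm c)) // ltW // (lt_le_trans (archi_boundP (normr_ge0 c))) // ler_nat.
  by near: N; exact: nbhs_infty_ge.
exists (N%:R + 1); first by rewrite ltr_wpDl.
move=> z /(HN N (leqnn N)) HF; rewrite (le_trans HF) // ler_wpM2r // lerDl ler01.
Unshelve. all: by end_near. Qed.

(* [zero_set_dim] for (x, w) |-> f (x + w) - f x on a ball around (a, b - a). *)
Lemma double_point_dim s p (f : 'rV[C]_s -> 'rV[C]_p) (a b : 'rV[C]_s) (R0 : R) :
  0 < R0 -> (forall x, differentiable f x) -> f a = f b ->
  (a <> b \/ exists2 v, v != 0 & 'd f a v = 0) ->
  (forall x0 w0 : 'rV[C]_s, ~ (x0 = a /\ x0 + w0 = b) ->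
     rnorm (x0 - a) <= R0 -> rnorm (w0 - (b - a)) <= R0 ->
     exists c d : R, [/\ 0 < c, 0 < d & forall x w, rnorm (x - x0) < d -> rnorm (w - w0) < d ->
       rnorm w <= c * rnorm (f (x + w) - f x)]) ->
  (s + s <= p)%N.
Proof.
move=> R00 df fab hab loc.
pose Phi (z : 'rV[C]_(s + s)) := f (lsubmx z + rsubmx z) - f (lsubmx z).
have dPhi z : differentiable Phi z.
  have dl : differentiable (fun z : 'rV[C]_(s + s) => lsubmx z) z by exact: differentiable_lsubmx.
  have dr : differentiable (fun z : 'rV[C]_(s + s) => rsubmx z) z by exact: differentiable_rsubmx.
  apply: differentiableB.
    apply: (@differentiable_comp _ _ _ _ (fun z : 'rV[C]_(s + s) => lsubmx z + rsubmx z) f).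
      exact: differentiableD dl dr.
    exact: df.
  apply: (@differentiable_comp _ _ _ _ (fun z : 'rV[C]_(s + s) => lsubmx z) f); first exact: dl.
  exact: df.
pose zs := row_mx a (b - a).
have [c c0 Hc] : exists2 c : R, 0 < c & forall z, rnorm (z - zs) = R0 ->
    rnorm (rsubmx z) <= c * rnorm (Phi z).
  apply: (compact_uniform_bound (@compact_sphere _ zs R0)) => [z|z0 /= z0R]; first exact: rnorm_ge0.
  have zlr : rnorm (lsubmx z0 - a) <= R0 /\ rnorm (rsubmx z0 - (b - a)) <= R0.
    have -> : lsubmx z0 - a = lsubmx (z0 - zs) by rewrite [RHS]linearB /zs /= row_mxKl.
    have -> : rsubmx z0 - (b - a) = rsubmx (z0 - zs) by rewrite [RHS]linearB /zs /= row_mxKr.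
    by rewrite -z0R rnorm_lsubmx rnorm_rsubmx.
  have [zl zr] := zlr.
  have [|c [d [c0 d0 Hd]]] := loc (lsubmx z0) (rsubmx z0) _ zl zr.
    move=> [E1 E2]; move: R00; rewrite -z0R -[z0]hsubmxK /zs -E2 E1.
    by rewrite [a + _]addrC addrK subrr rnorm0 ltxx.
  exists c, d; split => // z zd; apply: Hd; rewrite -linearB /=.
    exact: le_lt_trans (rnorm_lsubmx _) zd.
  exact: le_lt_trans (rnorm_rsubmx _) zd.
have main k : (forall eta : R, 0 < eta -> exists z : 'rV[C]_(s + s),
     [/\ rnorm (z - zs) < R0, rsubmx z 0 k != 0 & rnorm (Phi z) <= eta * rnorm (rsubmx z 0 k)]) ->
   (s + s <= p)%N.
  move=> H; apply: (@zero_set_dim _ _ _ Phi (rshift s k) zs R0 c^-1); rewrite ?invr_gt0 //.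
    move=> z /Hc Hz; rewrite ler_pdivrMl //; apply: le_trans Hz.
    by have := rnorm_coord (rsubmx z) k; rewrite mxE.
  by move=> eta /H[z]; rewrite mxE => ?; exists z.
have main_ab : a <> b -> (s + s <= p)%N.
  (* The centre itself serves for every [eta]: [Phi] vanishes there, while some coordinate of
     [b - a] does not. *)
  move=> nab; have /rV0Pn[k bk] : b - a != 0 by rewrite subr_eq0 eq_sym; exact/eqP.
  apply: (main k) => eta eta0; exists zs; rewrite /Phi row_mxKl row_mxKr subrr rnorm0.
  split => //.
  rewrite [a + _]addrC subrK fab subrr rnorm0 mulr_ge0 ?rnorm_ge0 //; exact: ltW.
case: hab => [//|[v v0 dv]].
have [ab|/eqP/main_ab//] := eqVneq a b.
have /rV0Pn[k vk] := v0.
apply: (main k) => eta eta0.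
have nv : 0 < rnorm v by rewrite rnorm_gt0.
have nk : 0 < rnorm (v 0 k) by rewrite rnorm_gt0.
(* Now the centre has second component 0. At [(a, t v)] with small [t] the value of [Phi] is o(t),
   whereas the k-th coordinate of the second component is [t * v_k]. *)
have [d d0 Hd] := differentiable_eps (df a) (divr_gt0 (mulr_gt0 eta0 nk) nv).
pose t := Num.min (d / (2 * rnorm v)) (R0 / (2 * rnorm v)).
have x2 : 0 < 2 * rnorm v by lra.
have t0 : 0 < t by rewrite lt_min !divr_gt0.
have [td tR] : t <= d / (2 * rnorm v) /\ t <= R0 / (2 * rnorm v).
  by rewrite /t !ge_min !lexx orbT.
clearbody t; move: td tR; rewrite !ler_pdivlMr // => td tR.
have tv := mulr_gt0 t0 nv.
have ntv : rnorm (t%:C%C *: v) = t * rnorm v by rewrite rnormZ rnormR gtr0_norm.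
exists (row_mx a (t%:C%C *: v)); rewrite /Phi row_mxKl row_mxKr; split.
- rewrite /zs -ab subrr opp_row_mx add_row_mx subrr subr0.
  by apply: le_lt_trans (rnorm_row0 _ _) _; rewrite ntv; lra.
- by rewrite mxE mulf_neq0 // -rnorm_gt0 rnormR gtr0_norm.
- have d1 : 'd f a (t%:C%C *: v) = 0 by rewrite linearZ dv; exact: scaler0.
  have := Hd (t%:C%C *: v); rewrite ntv d1 subr0 mxE rnormM rnormR gtr0_norm //.
  move=> /(_ _)/le_trans; apply; first by lra.
  by rewrite le_eqVlt; apply/orP; left; apply/eqP; field; rewrite gt_eqF.
Qed.
End DoublePoints.

(** * The normalization over a nonsingular point *)

Section LocalInjectivity.
Variable R : realType.
Local Notation C := R[i].

Lemma differentiable_near_eq (V W : normedModType C) (f g : V -> W) x :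
  (\forall y \near x, f y = g y) -> differentiable g x -> differentiable f x.
Proof.
move=> /near_rnormP[d d0 E] dg.
have Ex h : rnorm h < d -> f (x + h) = g (x + h) by move=> hd; apply: E; rewrite addrC addKr.
have [] // := @eps_differentiable _ _ _ f ('d g x) x.
  exact: diff_continuous.
move=> e e0; have [d1 d10 H] := differentiable_eps dg e0.
exists (Num.min d d1); first by rewrite lt_min d0.
move=> h; rewrite lt_min => /andP[h1 h2]; rewrite Ex //.
by rewrite -[f x]/(f x) -[in f x](addr0 x) Ex ?rnorm0 // addr0 H.
Qed.

Lemma open_rnorm (V : normedModType C) (U : set V) x : open U -> U x ->
  exists2 d : R, 0 < d & forall y, rnorm (y - x) < d -> U y.
Proof. by move=> oU Ux; apply/near_rnormP; exact: open_nbhs_nbhs. Qed.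

Lemma continuous_rnorm (V W : normedModType C) (f : V -> W) x : {for x, continuous f} ->
  forall e : R, 0 < e -> exists2 d : R, 0 < d &
    forall y, rnorm (y - x) < d -> rnorm (f y - f x) < e.
Proof.
move=> cf e e0; apply/near_rnormP.
have ec : 0 < e%:C%C :> C by rewrite ltcR.
move/cvgrPdist_lt : cf => /(_ _ ec); apply: filterS => y.
by rewrite distrC rnormE ltcR.
Qed.

Lemma holomorphic_on_open n m (U : set 'rV[C]_n) (f : 'rV[C]_n -> 'rV[C]_m) x :
  open U -> holomorphic_on U f -> U x -> differentiable f x.
Proof.
move=> oU hf Ux; have [U1 [g [oU1 U1x dg E]]] := hf x Ux.
apply: (@differentiable_near_eq _ _ f g); last exact: dg.
have : nbhs x (U `&` U1) by apply: open_nbhs_nbhs; split => //; exact: openI.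
by apply: filterS => y [Uy U1y]; exact: E.
Qed.

Lemma compact_rnorm_bounded (V : normedModType C) (K : set V) : compact K ->
  exists M : R, forall x, K x -> rnorm x <= M.
Proof.
move=> cK; have [->|/set0P K0] := eqVneq K set0; first by exists 0.
have [|c _ Hc] := @compact_EVT_max _ R (@rnorm R V) K K0 cK.
  by apply: continuous_subspaceT => x; exact: rnorm_continuous.
by exists (rnorm c) => x Kx; apply: Hc; rewrite inE.
Qed.

(** Several equations cut out the exceptional set, but [line_schwarz] takes one scalar function that
    is nonzero at both end points. A combination of two coordinates provides it. *)
Lemma separating_functional k (u v : 'rV[C]_k) : u != 0 -> v != 0 ->
  exists (i j : 'I_k) (c d : C),
    c * u 0 i + d * u 0 j != 0 /\ c * v 0 i + d * v 0 j != 0.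
Proof.
move=> /rV0Pn[i ui] /rV0Pn[j vj].
have [vi|vi] := eqVneq (v 0 i) 0; last by exists i, i, 1, 0; rewrite !mul1r !mul0r !addr0.
have [uj|uj] := eqVneq (u 0 j) 0; last by exists j, j, 1, 0; rewrite !mul1r !mul0r !addr0.
by exists i, j, 1, 1; rewrite !mul1r vi uj addr0 add0r.
Qed.

Lemma dense_rnorm (V : normedModType C) (S : set V) x (d : R) : dense S -> 0 < d ->
  exists2 y, S y & rnorm (y - x) < d.
Proof.
move=> dS d0; have nx : nbhs x [set y | rnorm (y - x) < d] by apply/near_rnormP; exists d.
have [|y [yi Sy]] := dS (interior [set y | rnorm (y - x) < d]) _ (@open_interior _ _).
  by exists x.
by exists y => //; exact: (interior_subset yi).
Qed.

(* In a chart of X at y0 the inverse g of f is holomorphic off the zero set of the holomorphic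
   map gN and bounded because f is proper, hence Lipschitz there by [line_schwarz]; density and
   continuity extend the estimate across N. *)
Lemma normalization_locally_expanding s p (X : set 'rV[C]_p) (f : 'rV[C]_s -> 'rV[C]_p) y0 :
  is_smooth_normalization X f -> nonsingular_point X y0 ->
  exists d L : R, [/\ 0 < d, 0 < L & forall x x',
    rnorm (f x - y0) < d -> rnorm (f x' - y0) < d -> rnorm (x - x') <= L * rnorm (f x - f x')].
Proof.
move=> [hf rf [pf _] [N [aN NX _ dN [g [_ hg gK fK]]]]].
move=> [dd [Xy0 _ [U [V [phi [oU oV Uy0 [psi [hphi hpsi phiK psiK]] slice]]]]]].
have df x : differentiable f x by apply: (holomorphic_on_open openT hf).
have [U1 [k [gN [oU1 U1y0 hgN NE]]]] := aN y0.
have dphi y : U y -> differentiable phi y by exact: holomorphic_on_open.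
have dpsi z : V z -> differentiable psi z by exact: holomorphic_on_open.
have dgN y : U1 y -> differentiable gN y by exact: holomorphic_on_open.
have [Vz0 psiz0] := phiK _ Uy0; set z0 := phi y0 in Vz0 psiz0.
have [M HM] : exists M : R, forall x, rnorm (f x - y0) <= 1 -> rnorm x <= M.
  have [M HM] := compact_rnorm_bounded (pf _ (@compact_closed_ball _ _ y0 1)).
  by exists M => x fx; exact: HM.
have [e1 e10 He1] := open_rnorm oU1 U1y0.
have [e2 e20 He2] := continuous_rnorm (differentiable_continuous (dgN _ U1y0)) ltr01.
have [d1 d10 Hd1] := open_rnorm oV Vz0.
have e120 : 0 < Num.min 1 (Num.min e1 e2) by rewrite !lt_min ltr01 e10.
have [d2 d20 Hd2] := continuous_rnorm (differentiable_continuous (dpsi _ Vz0)) e120.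
rewrite psiz0 in Hd2.
pose r := Num.min d1 d2; have r0 : 0 < r by rewrite lt_min d10.
have inV z : rnorm (z - z0) < r -> V z.
  by rewrite lt_min => /andP[/Hd1].
have inU1 z : rnorm (z - z0) < r -> [/\ U1 (psi z), rnorm (psi z - y0) <= 1 &
    rnorm (gN (psi z)) <= rnorm (gN y0) + 1].
  rewrite lt_min => /andP[_ /Hd2]; rewrite !lt_min => /and3P[h1 h2 h3].
  split; [exact: He1|exact: ltW|].
  by have := He2 _ h3; have := rdist_ge (gN (psi z)) (gN y0); lra.
clearbody r.
(* The line through two points of the coordinate slice stays in the slice, so [psi] maps its part
   near [z0] into [X], and into [X] minus [N] where [gam] is nonzero. *)
have slip a b : rnorm (a - z0) < r / 16 -> rnorm (b - z0) < r / 16 ->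
    coord_subspace dd a -> coord_subspace dd b -> ~ N (psi a) -> ~ N (psi b) ->
    rnorm (g (psi b) - g (psi a)) <= 8 * M / (r / 2) * rnorm (b - a).
  move=> ar br ca cb na nb.
  have inr z : rnorm (z - z0) < r / 16 -> rnorm (z - z0) < r by move=> ?; lra.
  have nz z : rnorm (z - z0) < r -> gN (psi z) <> 0 <-> ~ N (psi z).
    by move=> /inU1[h _ _]; rewrite NE.
  have /eqP ga := (nz _ (inr _ ar)).2 na; have /eqP gb := (nz _ (inr _ br)).2 nb.
  have [i [j [c [d [ua ub]]]]] := separating_functional ga gb.
  pose gam z := c * gN (psi z) 0 i + d * gN (psi z) 0 j.
  apply: (@line_schwarz _ _ _ (g \o psi) gam a b (r / 2) M
     ((rnorm c + rnorm d) * (rnorm (gN y0) + 1))) => //; first by lra.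
    by rewrite (le_trans (rdist_trans z0 _ _)) // (rdistC z0); lra.
  have hgam t : rnorm (a + t *: (b - a) - z0) < r -> hol (fun t => gam (a + t *: (b - a))) t.
    move=> zr; have dz : differentiable (gN \o psi) (a + t *: (b - a)).
      apply: differentiable_comp; first exact: dpsi (inV _ zr).
      by have [h _ _] := inU1 _ zr; exact: dgN.
    apply/holP; apply: differentiableD; apply: differentiableM; try exact: differentiable_cst;
      by apply/holP; exact: (@hol_line_coord _ _ _ (gN \o psi)).
  move=> t tr; set z := a + t *: (b - a).
  have zr : rnorm (z - z0) < r.
    rewrite /z addrAC (le_lt_trans (rnormD _ _)) // rnormZ; lra.
  have [U1z pz gz] := inU1 _ zr.
  split; first exact: hgam.
    rewrite /gam (le_trans (rnormD _ _)) // !rnormM mulrDl.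
    by rewrite lerD // ler_wpM2l ?rnorm_ge0 // (le_trans (rnorm_coord _ _)).
  move=> gamz.
  have cz t' : coord_subspace dd (a + t' *: (b - a)).
    by move=> l dl; rewrite !mxE ca // cb // subrr mulr0 addr0.
  have Xz t' : rnorm (a + t' *: (b - a) - z0) < r -> X (psi (a + t' *: (b - a))).
    by move=> /inV Vz; have [Uz pK] := psiK _ Vz; apply/(slice _ Uz); rewrite pK.
  have XNz t' : rnorm (a + t' *: (b - a) - z0) < r -> gam (a + t' *: (b - a)) != 0 ->
      (X `\` N) (psi (a + t' *: (b - a))).
    move=> zr' gz'; split; first exact: Xz.
    apply/nz => // g0; move: gz'; rewrite /gam g0 !mxE !mulr0 addr0 eqxx //.
  have XNzz := XNz t zr gamz.
  split; last first.
    have [_ fg] := fK _ XNzz.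
    by apply: HM; rewrite /= fg.
  move=> l.
  have [U2 [g2 [oU2 U2z dg2 g2E]]] := hg _ XNzz.
  have dg2z : differentiable (g2 \o psi) z.
    by apply: differentiable_comp; [exact: dpsi (inV _ zr)|exact: dg2].
  (* [g] is only locally the restriction of a holomorphic [g2] to [X] minus [N]. For parameters
     close to [t] the line stays in that set and in the domain of [g2], so there [g \o psi] agrees
     with [g2 \o psi]. *)
  have [e3 e30 He3] : exists2 e3 : R, 0 < e3 & forall h, rnorm h < e3 ->
      [/\ rnorm (a + (t + h) *: (b - a) - z0) < r, gam (a + (t + h) *: (b - a)) != 0 &
       U2 (psi (a + (t + h) *: (b - a)))].
    have [b1 b10 B1] := open_rnorm oU2 U2z.
    have [b2 b20 B2] := continuous_rnorm (differentiable_continuous (dpsi _ (inV _ zr))) b10.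
    have gz0 : 0 < rnorm (gam z) / 2 by rewrite divr_gt0 // rnorm_gt0.
    have [b3 b30 B3] := hol_cont (hgam t zr) gz0.
    have ba1 : 0 < rnorm (b - a) + 1 by rewrite ltr_wpDl ?rnorm_ge0.
    pose q1 := (r - rnorm (z - z0)) / (rnorm (b - a) + 1); pose q2 := b2 / (rnorm (b - a) + 1).
    have q10 : 0 < q1 by rewrite divr_gt0 // subr_gt0.
    have q20 : 0 < q2 by rewrite divr_gt0.
    exists (Num.min q1 (Num.min q2 b3)); first by rewrite !lt_min q10 q20.
    move=> h; rewrite !lt_min !(ltr_pdivlMr _ _ ba1) => /and3P[h1 h2 h3].
    have E : a + (t + h) *: (b - a) = z + h *: (b - a) by rewrite scalerDl addrA.
    have hba : rnorm (h *: (b - a)) <= rnorm h * (rnorm (b - a) + 1).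
      by rewrite rnormZ ler_wpM2l ?rnorm_ge0 // lerDl.
    split.
    - rewrite E addrAC (le_lt_trans (rnormD _ _)) //.
      by move: h1 hba; clear; move=> *; lra.
    - apply/eqP => g0; have := B3 h h3; rewrite g0 sub0r rnormN -/z.
      by move: gz0; clear; move=> *; lra.
    - by rewrite E; apply: B1; apply: B2; rewrite addrAC subrr add0r (le_lt_trans hba).
  apply: (@hol_near_eq _ _ (fun t => (g2 \o psi) (a + t *: (b - a)) 0 l) t e3) => //.
    by move=> h /He3[h1 h2 h3] /=; rewrite (g2E _ h3 (XNz _ h1 h2)).
  exact: hol_line_coord.
have [e3 e30 He3] := open_rnorm oU Uy0.
have [e4 e40 He4] := continuous_rnorm (differentiable_continuous (dphi _ Uy0)) ltr01.
have r160 : 0 < r / 16 by lra.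
have [e5 e50 He5] := continuous_rnorm (differentiable_continuous (dphi _ Uy0)) r160.
have [q [q0 q3 q4]] : exists q : R, [/\ 0 < q, q <= e3 & q <= e4].
  by exists (Num.min e3 e4); rewrite lt_min e30 !ge_min !lexx orbT.
have [d [d0 dq d5]] : exists d : R, [/\ 0 < d, d <= q / 16 & d <= e5].
  by exists (Num.min (q / 16) e5); rewrite lt_min e50 !ge_min !lexx orbT divr_gt0.
(* Product of the Lipschitz constants of [g \o psi] on the slice and of the chart [phi], which is
   bounded by [rnorm z0 + 1] near [y0]. *)
pose L := `|8 * M / (r / 2)| * (16 * (rnorm z0 + 1) / q).
have L0 : 0 <= L.
  apply: mulr_ge0 => //; apply: divr_ge0; last exact: ltW.
  by apply: mulr_ge0 => //; apply: addr_ge0; rewrite ?rnorm_ge0.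
have Xf x : X (f x) by rewrite -rf; exists x.
have off x x' : rnorm (f x - y0) < d -> rnorm (f x' - y0) < d -> ~ N (f x) -> ~ N (f x') ->
    rnorm (x - x') <= L * rnorm (f x - f x').
  move=> xd xd' nx nx'.
  have fU y : rnorm (y - y0) < q -> U y by move=> yq; apply: He3; exact: lt_le_trans q3.
  have dq' : d <= q by move: dq q0; clear; move=> *; lra.
  have Ux : U (f x) by apply: fU; exact: lt_le_trans dq'.
  have Ux' : U (f x') by apply: fU; exact: lt_le_trans dq'.
  have [_ gx] := gK x nx; have [_ gx'] := gK x' nx'.
  have [_ px] := phiK _ Ux; have [_ px'] := phiK _ Ux'.
  have := slip (phi (f x')) (phi (f x)).
  rewrite px px' gx gx' => /(_ _ _ _ _ nx' nx)/le_trans; apply.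
  - by apply: He5; exact: lt_le_trans d5.
  - by apply: He5; exact: lt_le_trans d5.
  - by apply/(slice _ Ux').
  - by apply/(slice _ Ux).
  apply: (le_trans (ler_wpM2r (rnorm_ge0 _) (ler_norm _))).
  rewrite /L -[leRHS]mulrA; apply: ler_wpM2l => //.
  apply: (@holomorphic_lipschitz _ _ _ phi y0) => //.
  - by move=> y /fU; exact: dphi.
  - move=> y yq; have /He4 := lt_le_trans yq q4.
    by have := rdist_ge (phi y) z0; rewrite -/z0; clear; move=> *; lra.
  - exact: lt_le_trans dq.
  - exact: lt_le_trans dq.
exists d, (L + 1); split => //; first by lra.
move=> x x' xd xd'.
suff H : rnorm (x - x') <= L * rnorm (f x - f x').
  by rewrite (le_trans H) // ler_wpM2r ?rnorm_ge0 // lerDl.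
rewrite leNgt; apply/negP => lt.
(* Moving both points and their images by at most [eta], to avoid [N], costs at most
   [2 * (L + 1) * eta], half of the supposed excess. *)
pose eta := (rnorm (x - x') - L * rnorm (f x - f x')) / (4 * (L + 1)).
have L4 : 0 < 4 * (L + 1) by lra.
have eta0 : 0 < eta by rewrite divr_gt0 // subr_gt0.
have near z : rnorm (f z - y0) < d -> exists x1,
    [/\ rnorm (f x1 - y0) < d, ~ N (f x1), rnorm (z - x1) <= eta & rnorm (f z - f x1) <= eta].
  move=> zd.
  have m0 : 0 < Num.min eta (d - rnorm (f z - y0)) by rewrite lt_min eta0 subr_gt0.
  have [b1 b10 B1] := continuous_rnorm (differentiable_continuous (df z)) m0.
  have b1e : 0 < Num.min b1 eta by rewrite lt_min b10.
  have [x1 Nx1] := dense_rnorm z dN b1e.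
  rewrite lt_min => /andP[/B1]; rewrite lt_min => /andP[h1 h2] h3; exists x1; split.
  - by rewrite (le_lt_trans (rdist_trans (f z) _ _)) // -ltrBrDr.
  - exact: Nx1.
  - by rewrite rdistC ltW.
  - by rewrite rdistC ltW.
have [x1 [a1 a2 a3 a4]] := near x xd; have [x1' [a1' a2' a3' a4']] := near x' xd'.
have := off _ _ a1 a1' a2 a2'.
have t1 := rdist_trans x1 x x'; have t2 := rdist_trans x1' x1 x'; rewrite (rdistC x1') in t2.
have t3 := rdist_trans (f x) (f x1) (f x1'); have t4 := rdist_trans (f x') (f x) (f x1').
rewrite (rdistC (f x1) (f x)) in t3.
have t5 : rnorm (f x1 - f x1') <= rnorm (f x - f x') + 2 * eta.
  by move: t3 t4 a4 a4'; clear; move=> *; lra.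
have := ler_wpM2l L0 t5.
have : 4 * (L + 1) * eta = rnorm (x - x') - L * rnorm (f x - f x').
  by rewrite /eta mulrC divfK // gt_eqF.
have : 0 <= L * eta by rewrite mulr_ge0 // ltW.
by clearbody eta; move: t1 t2 a3 a3' eta0; clear; move=> *; lra.
Qed.
End LocalInjectivity.

(** * The inverse function theorem *)

Section InverseFunction.
Variable R : realType.
Local Notation C := R[i].

Lemma rnorm_mulmx n m (M : 'M[C]_(n, m)) :
  exists2 c : R, 0 < c & forall v : 'rV[C]_n, rnorm (v *m M) <= c * rnorm v.
Proof.
pose c : R := \sum_k \sum_j rnorm (M k j).
have c0 : 0 <= c by rewrite !sumr_ge0 // => k _; rewrite sumr_ge0 // => j _; exact: rnorm_ge0.
exists (c + 1); first by rewrite ltr_wpDl.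
move=> v; apply: (@le_trans _ _ (c * rnorm v)); last by rewrite ler_wpM2r ?rnorm_ge0 // lerDl.
apply: rnorm_rV_le => [|j]; first by rewrite mulr_ge0 ?rnorm_ge0.
rewrite mxE; apply: (@le_trans _ _ (\sum_k rnorm (v 0 k * M k j))).
  elim/big_ind2: _ => [|x1 x2 y1 y2 h1 h2|//]; first by rewrite rnorm0.
  by rewrite (le_trans (rnormD _ _)) // lerD.
rewrite /c mulr_suml; apply: ler_sum => k _; rewrite rnormM mulrC.
apply: ler_pM; rewrite ?rnorm_ge0 ?rnorm_coord //.
by rewrite (bigD1 j) //= lerDl sumr_ge0 // => ? _; exact: rnorm_ge0.
Qed.

Lemma mulmx_continuous n m (M : 'M[C]_(n, m)) : continuous (fun v : 'rV[C]_n => v *m M).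
Proof.
move=> v; have [c c0 Hc] := rnorm_mulmx M.
apply: cvg_rnorm => e e0; apply/near_rnormP; exists (e / c); first by rewrite divr_gt0.
move=> w wv; rewrite -mulmxBl (le_lt_trans (Hc _)) // mulrC -ltr_pdivlMr //.
Qed.

Lemma differentiable_mulmx n m (M : 'M[C]_(n, m)) v :
  differentiable (fun v : 'rV[C]_n => v *m M) v /\
  'd (fun v : 'rV[C]_n => v *m M) v = (fun v => v *m M) :> ('rV[C]_n -> 'rV[C]_m).
Proof.
have cM : continuous (mulmxr M : {linear 'rV[C]_n -> 'rV[C]_m}) by exact: mulmx_continuous.
by split; [exact: (linear_differentiable v cM)|exact: (diff_lin v cM)].
Qed.

Lemma open_rnormP (V : normedModType C) (U : set V) :
  (forall x, U x -> exists2 d : R, 0 < d & forall y, rnorm (y - x) < d -> U y) -> open U.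
Proof. by move=> H; rewrite openE => x /H /near_rnormP. Qed.

(** The remainder of the linear approximation at 0 is at most [e / 16 * d] on the ball of radius
    [d]; by [holomorphic_lipschitz] it has Lipschitz constant [e] on the ball of radius [d / 16]. *)
Lemma strictly_differentiable n m (Psi : 'rV[C]_n -> 'rV[C]_m) (e : R) :
  (forall z, differentiable Psi z) -> 0 < e ->
  exists2 r : R, 0 < r & forall z z', rnorm z < r -> rnorm z' < r ->
    rnorm (Psi z - Psi z' - 'd Psi 0 (z - z')) <= e * rnorm (z - z').
Proof.
move=> dPsi e0; have e16 : 0 < e / 16 by rewrite divr_gt0.
have [d d0 Hd] := differentiable_eps (dPsi 0) e16.
exists (d / 16); first by rewrite divr_gt0.
move=> z z' zr zr'; pose g z := Psi z - Psi 0 - 'd Psi 0 z.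
have -> : Psi z - Psi z' - 'd Psi 0 (z - z') = g z - g z'.
  by rewrite /g linearB /=; apply/rowP => j; rewrite !mxE; ring.
have -> : e = 16 * (e / 16 * d) / d by field; rewrite gt_eqF.
apply: (@holomorphic_lipschitz _ _ _ g 0).
- exact: d0.
- move=> w _; apply: differentiableB.
    by apply: differentiableB; [exact: dPsi|exact: differentiable_cst].
  exact: (linear_differentiable w (diff_continuous (dPsi 0))).
- move=> w; rewrite subr0 => wd; have := Hd w wd; rewrite add0r => /le_trans; apply.
  by rewrite ler_wpM2l // ltW.
- by rewrite subr0.
- by rewrite subr0.
Qed.

Lemma mulmx_lin1_diff n m (Psi : 'rV[C]_n -> 'rV[C]_m) z v :
  v *m lin1_mx ('d Psi z) = 'd Psi z v.
Proof. by rewrite mul_rV_lin1. Qed.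

(* Surjectivity: at a minimum z of |Psi z - y|, moving z by y - Psi z would halve the minimum. *)
Lemma inverse_function n (Psi : 'rV[C]_n -> 'rV[C]_n) :
  (forall z, differentiable Psi z) -> Psi 0 = 0 -> (forall v, 'd Psi 0 v = v) ->
  exists (r : R) (g : 'rV[C]_n -> 'rV[C]_n), [/\ 0 < r,
    forall z z', rnorm z < r -> rnorm z' < r -> Psi z = Psi z' -> z = z',
    forall y, rnorm y < r / 2 -> rnorm (g y) < r /\ Psi (g y) = y
  & forall y, rnorm y < r / 2 -> differentiable g y].
Proof.
move=> dPsi Psi0 d1.
have h0 : 0 < (2^-1 : R) by rewrite invr_gt0.
have [r1 r10 Hr1] := strictly_differentiable dPsi h0.
pose r := r1 / 2; have r0 : 0 < r by rewrite divr_gt0.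
have str z z' : rnorm z <= r -> rnorm z' <= r ->
    rnorm (Psi z - Psi z' - (z - z')) <= 2^-1 * rnorm (z - z').
  by move=> zr zr'; rewrite -[X in _ - X]d1; apply: Hr1; rewrite /r in zr zr'; lra.
have exp z z' : rnorm z <= r -> rnorm z' <= r ->
    rnorm (z - z') <= 2 * rnorm (Psi z - Psi z').
  move=> zr zr'; have := str z z' zr zr'.
  have := rdist_ge (z - z') (Psi z - Psi z'); rewrite (rdistC (z - z')); lra.
have surj y : exists z, rnorm y < r / 2 -> rnorm z < r /\ Psi z = y.
  have [yr|] := boolP (rnorm y < r / 2); last by exists 0.
  have K0 : [set z : 'rV[C]_n | rnorm (z - 0) <= r] !=set0.
    by exists 0; rewrite /= subrr rnorm0 ltW.
  have [|z] := @compact_EVT_min _ R (fun z => rnorm (Psi z - y)) _ K0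
      (@compact_closed_ball _ _ 0 r).
    apply: continuous_subspaceT => z.
    apply: (@continuous_comp _ _ _ Psi (fun w => rnorm (w - y))); last exact: rdist_continuous.
    exact/differentiable_continuous/dPsi.
  rewrite inE /= subr0 => zr zmin.
  pose z' := z + (y - Psi z).
  have Pz : rnorm (Psi z - z) <= 2^-1 * rnorm z.
    by have := str z 0 zr; rewrite rnorm0 Psi0 !subr0 => /(_ (ltW r0)).
  have z'r : rnorm z' < r.
    have -> : z' = y - (Psi z - z) by rewrite /z' opprB addrC addrA addrAC -addrA.
    by rewrite (le_lt_trans (rnormB _ _)) //; lra.
  have := zmin z'; rewrite inE /= subr0 => /(_ (ltW z'r)).
  have := str z' z (ltW z'r) zr.
  have -> : z' - z = y - Psi z by rewrite /z' addrC addKr.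
  have -> : Psi z' - Psi z - (y - Psi z) = Psi z' - y by rewrite opprB addrA subrK.
  rewrite (rdistC y) => h1 h2.
  have yz : Psi z - y = 0.
    by apply/eqP; rewrite -rnorm_eq0 eq_le rnorm_ge0 andbT; lra.
  exists z => _; split; last by apply/eqP; rewrite -subr_eq0 yz.
  move: z'r; rewrite /z' -opprB yz oppr0 addr0 //.
have [g Hg] := choice surj.
exists r, g; split => //.
  move=> z z' zr zr' E; apply/eqP; rewrite -subr_eq0 -rnorm_eq0 eq_le rnorm_ge0 andbT.
  by have := exp z z' (ltW zr) (ltW zr'); rewrite E subrr rnorm0 mulr0.
move=> y0 y0r; have [z0r Pz0] := Hg _ y0r; set z0 := g y0 in z0r Pz0.
(* Strict differentiability contributes 1/2 and the linear approximation at [z0], along a short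
   multiple of [v], contributes 1/4. As 3/4 is below 1, the differential at [z0] is invertible. *)
have near_id v : rnorm ('d Psi z0 v - v) <= 3 / 4 * rnorm v.
  have [->|v0] := eqVneq v 0; first by rewrite linear0 subrr !rnorm0 mulr0.
  have nv : 0 < rnorm v by rewrite rnorm_gt0.
  have q0 : 0 < (4^-1 : R) by rewrite invr_gt0.
  have [d d0 Hd] := differentiable_eps (dPsi z0) q0.
  have [t [t0 td tr]] : exists t : R, [/\ 0 < t, t * rnorm v < d & t * rnorm v < r - rnorm z0].
    have m0 : 0 < Num.min d (r - rnorm z0) by rewrite lt_min d0 subr_gt0.
    exists (Num.min d (r - rnorm z0) / 2 / rnorm v); rewrite divfK ?gt_eqF // !divr_gt0 //.
    have [m1 m2] : Num.min d (r - rnorm z0) <= d /\ Num.min d (r - rnorm z0) <= r - rnorm z0.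
      by rewrite !ge_min !lexx orbT.
    by split=> //; move: m0 m1 m2; clear; move=> *; lra.
  have ntv : rnorm (t%:C%C *: v) = t * rnorm v by rewrite rnormZ rnormR gtr0_norm.
  have z1 : rnorm (z0 + t%:C%C *: v) <= r.
    by rewrite (le_trans (rnormD _ _)) // ntv; lra.
  have h1 := str _ _ z1 (ltW z0r); have h2 := Hd (t%:C%C *: v).
  rewrite [z0 + _]addrC addrK ntv in h1; rewrite ntv [z0 + _]addrC in h2.
  have {}h2 := h2 td.
  rewrite -(ler_pM2l t0) -[t in leLHS](gtr0_norm t0) -rnormR -rnormZ scalerBr -linearZ /=.
  set S := Psi _ - _ in h1 h2.
  have := rdist_trans S ('d Psi z0 (t%:C%C *: v)) (t%:C%C *: v).
  by rewrite (rdistC _ S); move: h1 h2; clear; move=> *; lra.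
pose A := lin1_mx ('d Psi z0).
have AE (v : 'rV[C]_n) : v *m A = 'd Psi z0 v by exact: mulmx_lin1_diff.
have uA : A \in unitmx.
  rewrite -row_free_unit -kermx_eq0; apply/negPn/negP => /rowV0Pn[v /sub_kermxP vA v0].
  have := near_id v; rewrite -AE vA sub0r rnormN; have : 0 < rnorm v by rewrite rnorm_gt0.
  lra.
have [c c0 Hc] := rnorm_mulmx (invmx A).
have [] // := @eps_differentiable _ _ _ g (mulmxr (invmx A) : {linear 'rV[C]_n -> 'rV[C]_n}) y0.
  exact: mulmx_continuous.
(* Here [c] bounds the inverse of the differential, and 2 is the Lipschitz constant of [g]. *)
move=> e e0; have e1 : 0 < e / (2 * c) by rewrite divr_gt0 // mulr_gt0.
have [d d0 Hd] := differentiable_eps (dPsi z0) e1.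
exists (Num.min (d / 2) (r / 2 - rnorm y0)).
  by rewrite lt_min divr_gt0 // subr_gt0.
move=> k; rewrite lt_min => /andP[k1 k2].
have [zr Pz] : rnorm (g (y0 + k)) < r /\ Psi (g (y0 + k)) = y0 + k.
  by apply: Hg; rewrite (le_lt_trans (rnormD _ _)) // -ltrBrDl.
set h := g (y0 + k) - z0.
have kE : y0 + k - y0 = k by rewrite addrAC subrr add0r.
have hk : rnorm h <= 2 * rnorm k.
  by have := exp _ _ (ltW zr) (ltW z0r); rewrite Pz Pz0 kE.
have H : rnorm (k - h *m A) <= e / (2 * c) * rnorm h.
  have := Hd h; rewrite [z0 + h]addrC subrK Pz Pz0 kE -AE; apply; lra.
have -> : h - mulmxr (invmx A) k = - ((k - h *m A) *m invmx A).
  by rewrite /= mulmxBl mulmxK // opprB.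
rewrite rnormN (le_trans (Hc _)) // (le_trans (ler_wpM2l (ltW c0) H)) //.
rewrite (le_trans (ler_wpM2l _ (ler_wpM2l _ hk))) ?(ltW c0) ?(ltW e1) //.
by rewrite le_eqVlt; apply/orP; left; apply/eqP; field; rewrite gt_eqF.
Qed.

End InverseFunction.

(** * Immersions and regular points *)

Section Immersion.
Variable R : realType.
Local Notation C := R[i].

Lemma mul_pid_mxE n s (z : 'rV[C]_n) i : (z *m pid_mx s : 'rV[C]_n) 0 i = z 0 i *+ (i < s)%N.
Proof.
rewrite mxE (bigD1 i) //= mxE eqxx /= big1 ?addr0.
  by rewrite mulr_natr.
by move=> k; rewrite -val_eqE mxE => /negbTE ->; rewrite mulr0.
Qed.

Lemma coord_subspaceE n s (z : 'rV[C]_n) : coord_subspace s z <-> z *m copid_mx s = 0.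
Proof.
rewrite /copid_mx mulmxBr mulmx1; split=> [H|/eqP].
  apply/eqP; rewrite subr_eq0; apply/eqP/rowP => i; rewrite mul_pid_mxE.
  by have [si|/H ->] := ltnP i s; rewrite ?mul0rn.
rewrite subr_eq0 => /eqP zE i si.
by rewrite zE mul_pid_mxE ltnNge si.
Qed.

(** On the compact set where |f| <= 1 and |x - a| >= eta, [f] has no zero, so |f| is bounded below
    there. Thus no part of the image coming from far away gets close to 0. *)
Lemma proper_small_values s p (f : 'rV[C]_s -> 'rV[C]_p) a (eta : R) :
  (forall x, differentiable f x) -> (forall K, compact K -> compact (f @^-1` K)) ->
  (forall x, f x = 0 -> x = a) -> 0 < eta ->
  exists2 rho : R, 0 < rho & forall x, rnorm (f x) < rho -> rnorm (x - a) < eta.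
Proof.
move=> df pf fa eta0.
pose K := (f @^-1` [set y | rnorm (y - 0) <= 1]) `&` [set x | eta <= rnorm (x - a)].
have cK : compact K.
  apply: compact_closedI; first exact/pf/compact_closed_ball.
  suff : closed ((fun x : 'rV[C]_s => rnorm (x - a)) @^-1` [set t | eta <= t]) by [].
  by apply: preimage_closed; [move=> z _; exact: rdist_continuous|exact: closed_ge].
have [||c c0 Hc] := @compact_uniform_bound _ _ K (fun=> 1) (fun x => rnorm (f x)) cK.
- by move=> x; exact: rnorm_ge0.
- move=> x [_ /= xa].
  have fx0 : 0 < rnorm (f x).
    by rewrite rnorm_gt0; apply/eqP => /fa xE; move: xa; rewrite xE subrr rnorm0 leNgt eta0.
  have f2 : 0 < rnorm (f x) / 2 by rewrite divr_gt0.
  have [d d0 Hd] := continuous_rnorm (differentiable_continuous (df x)) f2.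
  exists (2 / rnorm (f x)), d; split => // x' /Hd H.
  rewrite mulrAC ler_pdivlMr // mul1r.
  have := rdist_ge (f x) (f x - f x'); rewrite subKr (rdistC (f x)).
  by move: H fx0; clear; move=> *; lra.
exists (Num.min 1 c^-1); first by rewrite lt_min ltr01 invr_gt0.
move=> x; rewrite lt_min => /andP[f1 fc]; rewrite ltNge; apply/negP => xa.
have := Hc x; rewrite leNgt => /(_ _)/negP; apply; first by split=> //=; rewrite subr0 ltW.
by rewrite mulrC -ltr_pdivlMr // div1r.
Qed.

Lemma differentiable_affine n m (a : 'rV[C]_m) (P : 'M[C]_(n, m)) z :
  differentiable (fun z : 'rV[C]_n => a + z *m P) z.
Proof.
by apply: (@differentiableD _ _ _ (cst a) _ z); [exact: differentiable_cst|
  have [] := differentiable_mulmx P z].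
Qed.

(* Psi z = f (a + z P) + z Q is tangent to the identity at 0 and maps the subspace z Q = 0 onto
   the image of f. *)
Lemma immersion_regular_point s p (X : set 'rV[C]_p) (f : 'rV[C]_s -> 'rV[C]_p) a :
  (forall x, differentiable f x) -> (forall K, compact K -> compact (f @^-1` K)) ->
  range f = X -> f a = 0 -> (forall x, f x = 0 -> x = a) ->
  (forall v, 'd f a v = 0 -> v = 0) -> regular_point X s 0.
Proof.
move=> df pf rf fa0 fa inj.
pose J := lin1_mx ('d f a).
have JE (v : 'rV[C]_s) : v *m J = 'd f a v by exact: mulmx_lin1_diff.
have rJ : \rank J = s.
  apply/eqP; rewrite -/(row_free J) -kermx_eq0; apply/negPn/negP => /rowV0Pn[v /sub_kermxP vJ].
  by rewrite (inj v) ?eqxx // -JE.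
have sp : (s <= p)%N by rewrite -rJ rank_leq_col.
pose E := row_ebase J; pose C0 := col_ebase J.
have uE : E \in unitmx by exact: row_ebase_unit.
have uC : C0 \in unitmx by exact: col_ebase_unit.
have JCE : C0 *m pid_mx s *m E = J by rewrite -[RHS]mulmx_ebase rJ.
pose T := invmx E.
(* For row vectors, [P] undoes [J] and [Q] is the complementary projection, which kills the image of
   [J]: this is the content of [PQ], [JP] and [JQ]. *)
pose P := T *m pid_mx s *m invmx C0 : 'M[C]_(p, s).
pose Q := T *m copid_mx s *m E : 'M[C]_p.
have PQ : P *m J + Q = 1%:M.
  have -> : P *m J = T *m pid_mx s *m E.
    rewrite -JCE /P -[C0 *m _ *m E]mulmxA [LHS]mulmxA mulmxKV // [LHS]mulmxA.
    by rewrite -[_ *m pid_mx s *m pid_mx s]mulmxA mul_pid_mx !minnn.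
  by rewrite -mulmxDl -mulmxDr /copid_mx addrC subrK mulmx1 mulVmx.
have JP : J *m P = 1%:M.
  rewrite -JCE /P !mulmxA mulmxK // -[_ *m pid_mx s *m pid_mx s]mulmxA mul_pid_mx !minnn.
  by rewrite (minn_idPr sp) pid_mx_1 mulmx1 mulmxV.
have JQ : J *m Q = 0.
  rewrite -JCE /Q !mulmxA mulmxK // -[_ *m pid_mx s *m copid_mx s]mulmxA mul_pid_mx_copid //.
  by rewrite mulmx0 mul0mx.
pose Psi (z : 'rV[C]_p) := f (a + z *m P) + z *m Q.
have dPsi z : differentiable Psi z.
  have [d1 _] := differentiable_mulmx Q z; have d2 := differentiable_affine a P z.
  apply: (@differentiableD _ _ _ (fun z : 'rV[C]_p => f (a + z *m P)) _ z _ d1).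
  exact: (differentiable_comp d2 (df _)).
have Psi0 : Psi 0 = 0 by rewrite /Psi !mul0mx !addr0.
have dPsi0 v : 'd Psi 0 v = v.
  have cid : continuous (idfun : 'rV[C]_p -> 'rV[C]_p) by move=> x; exact: cvg_id.
  suff H : forall e : R, 0 < e -> exists2 d : R, 0 < d & forall h, rnorm h < d ->
      rnorm (Psi (0 + h) - Psi 0 - idfun h) <= e * rnorm h.
    by have [_ ->] := @eps_differentiable R _ _ Psi idfun 0 cid H.
  move=> e e0; have [c c0 Hc] := rnorm_mulmx P.
  have [d d0 Hd] := differentiable_eps (df a) (divr_gt0 e0 c0).
  exists (d / c); first by rewrite divr_gt0.
  move=> h; rewrite ltr_pdivlMr // => hd.
  have {}hd : rnorm (h *m P) < d by rewrite (le_lt_trans (Hc h)) // mulrC.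
  have hE : 'd f a (h *m P) + h *m Q = h by rewrite -JE -mulmxA -mulmxDr PQ mulmx1.
  have -> : Psi (0 + h) - Psi 0 - idfun h = f (a + h *m P) - f a - 'd f a (h *m P).
    by rewrite Psi0 add0r subr0 /Psi -[X in _ - X]hE fa0 subr0 opprD addrACA subrr addr0.
  rewrite (le_trans (Hd _ hd)) //.
  have := ler_wpM2l (ltW (divr_gt0 e0 c0)) (Hc h).
  by rewrite mulrA divfK ?gt_eqF.
have [r [g [r0 gI gS dg]]] := inverse_function dPsi Psi0 dPsi0.
have [c c0 Hc] := rnorm_mulmx J.
have eta0 : 0 < r / c by rewrite divr_gt0.
have [rho1 rho10 Hrho1] := proper_small_values df pf fa eta0.
have [rho [rho0 rr rr1]] : exists rho : R, [/\ 0 < rho, rho <= r / 2 & rho <= rho1].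
  by exists (Num.min (r / 2) rho1); rewrite lt_min rho10 divr_gt0 // !ge_min !lexx orbT.
pose U : set 'rV[C]_p := [set y | rnorm y < rho].
(* In the coordinates given by [E] the kernel of [Q] becomes the coordinate subspace of dimension
   [s]. *)
pose psi (z : 'rV[C]_p) := Psi (z *m E).
pose V : set 'rV[C]_p := [set z | rnorm (z *m E) < r /\ rnorm (psi z) < rho].
pose phi (y : 'rV[C]_p) := g y *m T.
have phiE y : phi y *m E = g y by rewrite /phi /T mulmxKV.
have Ug y : U y -> rnorm (g y) < r /\ Psi (g y) = y.
  by move=> Uy; apply: gS; exact: lt_le_trans rr.
have dpsi z : differentiable psi z.
  have [d1 _] := differentiable_mulmx E z.
  exact: (differentiable_comp d1 (dPsi _)).
have oU : open U.
  apply: open_rnormP => y Uy; exists (rho - rnorm y); first by rewrite subr_gt0.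
  move=> w wy; rewrite /U /= -[w](subrK y) (le_lt_trans (rnormD _ _)) //.
  by rewrite -ltrBrDr.
have oV : open V.
  apply: open_rnormP => z [z1 z2].
  have q1 : 0 < r - rnorm (z *m E) by rewrite subr_gt0.
  have q2 : 0 < rho - rnorm (psi z) by rewrite subr_gt0.
  have [b1 b10 B1] := continuous_rnorm (@mulmx_continuous _ _ _ E z) q1.
  have [b2 b20 B2] := continuous_rnorm (differentiable_continuous (dpsi z)) q2.
  exists (Num.min b1 b2); first by rewrite lt_min b10.
  move=> w; rewrite lt_min => /andP[/B1 h1 /B2 h2]; split.
    by rewrite -[w *m E](subrK (z *m E)) (le_lt_trans (rnormD _ _)) // -ltrBrDr.
  by rewrite -[psi w](subrK (psi z)) (le_lt_trans (rnormD _ _)) // -ltrBrDr.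
have X0 : X 0 by rewrite -rf; exists a.
split=> //; exists U, V, phi; split=> //.
- by rewrite /U /= rnorm0.
- exists psi; split.
  + move=> y Uy; exists U, phi; split=> //.
    move=> w Uw; apply: (@differentiable_comp _ _ _ _ g (fun v : 'rV[C]_p => v *m T)).
      by apply: dg; exact: lt_le_trans rr.
    by case: (differentiable_mulmx T (g w)).
  + by move=> z Vz; exists V, psi; split=> //.
  + by move=> y Uy; have [gr gy] := Ug y Uy; split; rewrite /V /psi /= phiE gy.
  + move=> z [zr pz]; split => //; have [gr gy] := Ug _ pz.
    by rewrite /phi (gI _ _ gr zr gy) /T mulmxK.
- move=> y Uy; have [gr gy] := Ug y Uy; split.
    (* A preimage [x] of [y] is close to [a] by properness, so [(x - a) *m J] lies in the ball where
       [Psi] is injective. [Psi] sends it to [f x], hence it equals [g y], and [Q] kills it. *)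
    rewrite -rf => -[x _ fx].
    have xa : rnorm (x - a) < r / c.
      by apply: Hrho1; rewrite fx; exact: lt_le_trans rr1.
    have zr : rnorm ((x - a) *m J) < r.
      by rewrite (le_lt_trans (Hc _)) // mulrC -ltr_pdivlMr.
    have gE : g y = (x - a) *m J.
      apply: gI => //; rewrite gy /Psi -!mulmxA JP JQ mulmx1 mulmx0 addr0.
      by rewrite [a + _]addrC subrK.
    apply/coord_subspaceE; rewrite /phi gE.
    have : (x - a) *m J *m Q *m T = 0 by rewrite -[_ *m J *m Q]mulmxA JQ mulmx0 mul0mx.
    by rewrite /Q !mulmxA mulmxK.
  move=> /coord_subspaceE; rewrite /phi => H.
  rewrite -rf; exists (a + g y *m P) => //.
  by rewrite -[RHS]gy /Psi /Q !mulmxA H mul0mx addr0.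
Qed.
End Immersion.

(** * Proof of the theorem *)

Lemma finite_isolated (R : realType) (V : normedModType R[i]) (S : set V) a : finite_set S ->
  exists2 d : R, 0 < d & forall x, rnorm (x - a) < d -> S x -> x = a.
Proof.
move=> fS; have cS : closed (S `\` [set a]).
  have /accessible_finite_set_closed : accessible_space V.
    exact/hausdorff_accessible/norm_hausdorff.
  by apply; exact: finite_setD.
have Ua : (~` (S `\` [set a])) a by case=> _; apply.
have oU : open (~` (S `\` [set a])) by rewrite openC.
have [d d0 Hd] := open_rnorm oU Ua.
by exists d => // x /Hd H Sx; apply: contrapT => xa; apply: H.
Qed.

Theorem proposition3p1 (R : realType) (p s : nat)
    (X : set 'rV[R[i]]_p) (f : 'rV[R[i]]_s -> 'rV[R[i]]_p) :
  analytic_set X ->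
  has_dim X s ->
  isolated_singularity X (0%R : 'rV[R[i]]_p) ->
  is_smooth_normalization X f ->
  (2 * s <= p)%N.
Proof.
move=> _ _ [[X0 sing0] /near_rnormP[rho rho0 nonsing]] norm.
have [hf rf [pf ff] _] := norm.
have df x : differentiable f x by exact: (holomorphic_on_open openT hf).
have Xf x : X (f x) by rewrite -rf; exists x.
have [a _ fa0] : range f 0 by rewrite rf.
(* Otherwise [a] is the only preimage of 0 and the differential there is injective, so 0 would be a
   regular point. In the second alternative [b = a] is taken. *)
have [b [fb0 hab]] : exists b, f b = 0 /\ (a <> b \/ exists2 v, v != 0 & 'd f a v = 0).
  apply: contrapT => nE; apply: sing0; exists s.
  apply: (@immersion_regular_point _ _ _ _ f a) => //.
    by move=> x fx; apply: contrapT => xa; apply: nE; exists x; split => //; left => ax; exact: xa.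
  move=> v dv; apply: contrapT => v0; apply: nE; exists a; split => //; right.
  by exists v => //; exact/eqP.
have [da da0 Ha] := finite_isolated a (ff 0); have [db db0 Hb] := finite_isolated b (ff 0).
have [dc dc0 Hc] := continuous_rnorm (differentiable_continuous (df a)) rho0.
rewrite fa0 in Hc.
(* The factor 2 is due to [x0 + w0 - b] being a sum of two displacements of size at most [R0]. The
   bound by [dc] keeps [f x0] in the neighbourhood where only 0 is singular. *)
have [R0 [R00 Ra Rb Rc]] : exists R0 : R, [/\ 0 < R0, R0 < da, 2 * R0 < db & R0 < dc].
  pose m := Num.min da (Num.min db dc).
  have [m1 m2 m3] : [/\ m <= da, m <= db & m <= dc] by rewrite /m !ge_min !lexx !orbT.
  have m0 : 0 < m by rewrite !lt_min da0 db0.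
  by exists (m / 3); split; lra.
rewrite mul2n -addnn; apply: (@double_point_dim _ _ _ f a b R0) => //; first by rewrite fa0.
move=> x0 w0 nab xa wb.
have cf x e : 0 < e -> exists2 d : R, 0 < d & forall y, rnorm (y - x) < d -> rnorm (f y - f x) < e.
  exact: continuous_rnorm (differentiable_continuous (df x)) e.
(* If the two values differ, then nearby |f (x + w) - f x| is at least half their distance while [w]
   stays bounded. *)
have [E|nE] := pselect (f (x0 + w0) = f x0); last first.
  have de0 : 0 < rnorm (f (x0 + w0) - f x0) / 4.
    by rewrite divr_gt0 // rnorm_gt0 subr_eq0; exact/eqP.
  have [d1 d10 H1] := cf x0 _ de0; have [d2 d20 H2] := cf (x0 + w0) _ de0.
  set de := rnorm _ in de0 H1 H2.
  exists ((rnorm w0 + 1) * 2 / de), (Num.min 1 (Num.min d1 (d2 / 2))).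
  have w1 : 0 < rnorm w0 + 1 by rewrite ltr_wpDl ?rnorm_ge0.
  have de1 : 0 < de by lra.
  split; [by rewrite divr_gt0 // mulr_gt0|by rewrite !lt_min ltr01 d10 divr_gt0|].
  move=> x w; rewrite !lt_min => /and3P[_ x1 x2] /and3P[w2 w3 w4].
  have ww : rnorm w <= rnorm w0 + 1.
    by have := rdist_ge w w0; move: w2; clear; move=> *; lra.
  have xw : rnorm (x + w - (x0 + w0)) < d2.
    rewrite opprD addrACA (le_lt_trans (rnormD _ _)) //.
    by move: x2 w4; clear; move=> *; lra.
  have fd : de / 2 <= rnorm (f (x + w) - f x).
    have := H1 _ x1; have := H2 _ xw.
    have := rdist_trans (f (x + w)) (f (x0 + w0)) (f x0); rewrite -/de (rdistC (f (x0 + w0))).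
    have := rdist_trans (f x) (f (x + w)) (f x0).
    by clear; move=> *; lra.
  rewrite mulrAC ler_pdivlMr //.
  apply: (le_trans (ler_wpM2r (ltW de1) ww)).
  have -> : (rnorm w0 + 1) * de = (rnorm w0 + 1) * 2 * (de / 2) by field.
  by rewrite ler_wpM2l // mulr_ge0 // ltW.
(* Were the common value 0, isolation of [a] and [b] in the fibre would give [x0 = a] and
   [x0 + w0 = b], which is excluded. So [f x0] is a nonsingular point, and the expansion estimate
   there forces [w0 = 0] and yields the bound. *)
have y0 : f x0 <> 0.
  move=> fx0; apply: nab; split; first by apply: Ha => //; exact: le_lt_trans Ra.
  apply: Hb; last by rewrite /= E.
  have -> : x0 + w0 - b = (x0 - a) + (w0 - (b - a)).
    by apply/rowP => j; rewrite !mxE; ring.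
  by rewrite (le_lt_trans (rnormD _ _)) //; lra.
have [|d [L [d0 L0 HL]]] := @normalization_locally_expanding _ _ _ _ _ (f x0) norm.
  apply: nonsing => //; rewrite subr0.
  have := Hc x0; rewrite subr0; apply; exact: le_lt_trans Rc.
have w00 : w0 = 0.
  have := HL x0 (x0 + w0); rewrite E subrr rnorm0 mulr0 opprD addrA subrr sub0r rnormN.
  by move=> /(_ d0 d0) H; apply/eqP; rewrite -rnorm_eq0 eq_le H rnorm_ge0.
have [e e0 He] := cf x0 _ d0.
exists L, (e / 2); split => //; first by rewrite divr_gt0.
move=> x w xe; rewrite w00 subr0 => we.
have := HL (x + w) x; rewrite [x + w - x]addrAC subrr add0r; apply.
  by apply: He; rewrite addrAC (le_lt_trans (rnormD _ _)) //; move: xe we; clear; move=> *; lra.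
by apply: He; move: xe e0; clear; move=> *; lra.
Qed.
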